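(* Let $\Omega\subseteq\mathbb{R}^d$ be a bounded domain with Lipschitz boundary. For $i=1,\dots,k$ let $C_i\subseteq\Omega$ and let $\mathbf{f}_i$ be the restriction to $C_i$ of a $C^{\alpha-1}$ vector field defined on an open neighbourhood of $C_i$, where $\alpha>d/2+2$. Let $D_iV(\mathbf{x}):=\nabla V(\mathbf{x})\cdot\mathbf{f}_i(\mathbf{x})$ for $\mathbf{x}\in C_i$. Let $b_i:C_i\to\mathbb{R}$ be continuous functions, and let $H=H^\alpha(\Omega)$ with norm given by an appropriate reproducing kernel. Consider the optimisation problem for $v\in H$ $$(\mathrm{P})\quad\begin{cases}\text{minimise }\|v\|_H\\ \text{subject to }D_iv(\mathbf{x}_i)\le b_i(\mathbf{x}_i)\ \text{ for all }i=1,\dots,k\text{ and all }\mathbf{x}_i\in C_i.\end{cases}$$ For each $n\in\mathbb{N}$ choose a finite set of points $Z_n=\{\mathbf{z}^{1,n},\dots,\mathbf{z}^{N_n,n}\}\subseteq\Omega$ and, for $i=1,\dots,k$, set $X_{i,n}:=Z_n\cap C_i=\{\mathbf{x}_i^{1,n},\dots,\mathbf{x}_i^{L_{i,n},n}\}$. Assume that for each $i$ the fill distance $$h_{X_{i,n},C_i}:=\sup_{\mathbf{x}_i\in C_i}\ \min_{\ell=1,\dots,L_{i,n}}\|\mathbf{x}_i-\mathbf{x}_i^{\ell,n}\|_2\quad\text{satisfies}\quad\lim_{n\to\infty}h_{X_{i,n},C_i}=0.$$ Assume furthermore that there exists $V_0\in H$ satisfying the constraints of $(\mathrm{P})$. For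 each $n\in\mathbb{N}$ consider the problem for $v\in H$ $$(\mathrm{P}_n)\quad\begin{cases}\text{minimise }\|v\|_H\\ \text{subject to }D_iv(\mathbf{x}_i^{\ell,n})\le b_i(\mathbf{x}_i^{\ell,n}),\ i=1,\dots,k,\ \ell=1,\dots,L_{i,n},\end{cases}$$ let $m_n:=\inf\{\|v\|_H: v\in H\text{ satisfies the constraints of }(\mathrm{P}_n)\}$, and, for some fixed $\varepsilon>0$, let $v_n^\varepsilon\in H$ satisfy the constraints of $(\mathrm{P}_n)$ with $\|v_n^\varepsilon\|_H\le\frac{\varepsilon}{n}+m_n$ for every $n\in\mathbb{N}$. Then the optimisation problem $(\mathrm{P})$ has a unique solution $v$, and the functions $v_n^\varepsilon$ converge strongly in $H$ to $v$ as $n\to\infty$.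
   Context: $H^\alpha(\Omega)=W^{\alpha,2}(\Omega)$ is the Sobolev space; for non-integer $\alpha$ it is defined by interpolation. Since $\alpha>d/2$ it is a reproducing kernel Hilbert space of continuous functions. ''Norm given by an appropriate reproducing kernel'' means: $\Phi_\alpha\in L_1(\mathbb{R}^d)\cap C(\mathbb{R}^d)$ is a function whose Fourier transform satisfies $c_1(1+\|w\|_2^2)^{-\alpha}\le\hat\Phi_\alpha(w)\le c_2(1+\|w\|_2^2)^{-\alpha}$ for all $w\in\mathbb{R}^d$, with constants $c_1,c_2>0$, and $H^\alpha(\Omega)$ is equipped with the inner product $\langle\cdot,\cdot\rangle_H$ for which $k_\alpha(\mathbf{x},\mathbf{y})=\Phi_\alpha(\mathbf{x}-\mathbf{y})$, $\mathbf{x},\mathbf{y}\in\Omega$, is the reproducing kernel; the induced norm $\|\cdot\|_H$ is equivalent to the standard norm of $H^\alpha(\Omega)$. The paper's standing assumptions are that the sets $C_i$ are closed and $\bigcup_{i=1}^kC_i=\Omega$, with $\mathbf{0}\in\Omega^\circ$ and $\mathbf{f}_i(\mathbf{0})=\mathbf{0}$ whenever $\mathbf{0}\in C_i$. *)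

(* Defs.v *)
From HB Require Import structures.
From mathcomp Require Import all_boot all_order all_algebra.
From mathcomp Require Import all_classical all_reals all_analysis.
From mathcomp Require Import complex.

Set Implicit Arguments.
Unset Strict Implicit.
Unset Printing Implicit Defensive.

Import Order.TTheory GRing.Theory Num.Theory numFieldNormedType.Exports.

Local Open Scope classical_set_scope.
Local Open Scope ring_scope.

(* 'rV[R]_n is given the product sigma-algebra, generated by the coordinates
   (as the library does for n.-tuple R); it is the Borel sigma-algebra. *)
Section measurable_rV.
Context (R : realType) (n : nat).

Definition rV_coord (i : 'I_n) (v : 'rV[R]_n) : measurableTypeR R := v 0 i.

Let rV_set0 : g_sigma_preimage rV_coord set0.
Proof. exact: sigma_algebra0. Qed.

Let rV_setC A : g_sigma_preimage rV_coord A -> g_sigma_preimage rV_coord (~` A).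
Proof. exact: sigma_algebraC. Qed.

Let rV_bigcup (F : (set 'rV[R]_n)^nat) :
  (forall i, g_sigma_preimage rV_coord (F i)) ->
  g_sigma_preimage rV_coord (\bigcup_i (F i)).
Proof. exact: sigma_algebra_bigcup. Qed.

HB.instance Definition _ := @isMeasurable.Build default_measure_display
  'rV[R]_n (g_sigma_preimage rV_coord) rV_set0 rV_setC rV_bigcup.

End measurable_rV.

Section measurable_fun_rV.
Context (R : realType) d (T : measurableType d).

Lemma measurable_rV_coord n (i : 'I_n) :
  measurable_fun [set: 'rV[R]_n] (@rV_coord R n i).
Proof.
move=> _ Y mY; rewrite setTI; apply: sub_sigma_algebra => /=.
rewrite -bigcup_seq/=; exists i => /=; first by rewrite mem_index_enum.
by exists Y => //; rewrite setTI.
Qed.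

Lemma measurable_fun_rV n (f : T -> 'rV[R]_n) :
  (forall i, measurable_fun [set: T] (@rV_coord R n i \o f)) ->
  measurable_fun [set: T] f.
Proof.
move=> mf; suff : g_sigma_preimage (fun i => @rV_coord R n i \o f) `<=` measurable.
  by rewrite g_sigma_preimage_comp => prefS _ A mA; apply: prefS; exists A.
apply: smallest_sub; first exact: sigma_algebra_measurable.
case: n => [|n] in f mf *; first by rewrite big_ord0.
rewrite -bigcup_mkord_ord; apply: bigcup_sub => i Ii.
by move=> A [B mB <-]; exact: mf.
Qed.

End measurable_fun_rV.

Section lebesgue_rV_succ.
Context (R : realType) (n : nat).

Definition rV_cons (p : measurableTypeR R * 'rV[R]_n) : 'rV[R]_n.+1 :=
  \row_i (if unlift ord0 i is Some j then p.2 0 j else p.1).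

Definition rV_uncons (v : 'rV[R]_n.+1) : measurableTypeR R * 'rV[R]_n :=
  (v 0 ord0, \row_j v 0 (lift ord0 j)).

Lemma rV_consK : cancel rV_cons rV_uncons.
Proof.
move=> [a v]; congr pair; first by rewrite mxE unlift_none.
by apply/rowP => j; rewrite !mxE liftK.
Qed.

Lemma measurable_rV_cons : measurable_fun setT rV_cons.
Proof.
apply: measurable_fun_rV => i; rewrite /comp /rV_coord /rV_cons.
case: (unliftP ord0 i) => [j|] ->.
  rewrite [X in measurable_fun _ X](_ : _ = @rV_coord R n j \o snd).
    by apply: measurableT_comp => //; exact: measurable_rV_coord.
  by apply/funext => p; rewrite mxE liftK.
rewrite [X in measurable_fun _ X](_ : _ = fst) //.
by apply/funext => p; rewrite mxE unlift_none.
Qed.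

Lemma measurable_rV_uncons : measurable_fun setT rV_uncons.
Proof.
apply: measurable_fun_pair => /=.
  exact: (@measurable_rV_coord R _ ord0).
apply: measurable_fun_rV => i.
rewrite [X in measurable_fun _ X](_ : _ = @rV_coord R n.+1 (lift ord0 i)).
  exact: measurable_rV_coord.
by apply/funext => v; rewrite /comp /rV_coord mxE.
Qed.

Variable mu : {sigma_finite_measure set 'rV[R]_n -> \bar R}.

Definition lebesgue_rV_succ :=
  pushforward ((@lebesgue_measure R) \x mu)%E rV_cons.

Let lebesgue_rV_succ0 : lebesgue_rV_succ set0 = 0%E.
Proof. by rewrite /lebesgue_rV_succ /pushforward preimage_set0 measure0. Qed.

Let lebesgue_rV_succ_ge0 A : (0 <= lebesgue_rV_succ A)%E.
Proof. by rewrite /lebesgue_rV_succ /pushforward measure_ge0. Qed.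

Let lebesgue_rV_succ_sigma_additive : semi_sigma_additive lebesgue_rV_succ.
Proof.
move=> F mF tF mUF; rewrite /lebesgue_rV_succ /pushforward preimage_bigcup.
apply: measure_semi_sigma_additive.
- by move=> k; rewrite -[X in measurable X]setTI; exact: measurable_rV_cons.
- apply/trivIsetP => /= i j _ _ ij; rewrite -preimage_setI.
  by move/trivIsetP : tF => /(_ _ _ _ _ ij) ->//; rewrite preimage_set0.
- rewrite -preimage_bigcup -[X in measurable X]setTI.
  exact: measurable_rV_cons.
Qed.

HB.instance Definition _ := isMeasure.Build _ _ _ lebesgue_rV_succ
  lebesgue_rV_succ0 lebesgue_rV_succ_ge0 lebesgue_rV_succ_sigma_additive.

Let lebesgue_rV_succ_sigma_finite : sigma_finite setT lebesgue_rV_succ.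
Proof.
have /sigma_finiteP[F [TF ndF Foo]] := sigma_finiteT (@lebesgue_measure R).
have /sigma_finiteP[G [TG ndG Goo]] := sigma_finiteT mu.
exists (fun k => rV_uncons @^-1` (F k `*` G k)).
  rewrite -preimage_bigcup [X in _ @^-1` X](_ : _ = setT) ?preimage_setT//.
  rewrite -setXTT TF TG predeqE => -[x y]; split.
    by move=> [k _ []/= ? ?]; split; exists k.
  move=> [/= [i _ Fix] [j _ Gjy]]; exists (maxn i j) => //; split.
  - by move: x Fix; exact/subsetPset/ndF/leq_maxl.
  - by move: y Gjy; exact/subsetPset/ndG/leq_maxr.
move=> k; have [mFk Fkoo] := Foo k; have [mGk Gkoo] := Goo k; split.
  rewrite -[X in measurable X]setTI.
  by apply: measurable_rV_uncons => //; exact: measurableX.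
rewrite /lebesgue_rV_succ /pushforward -comp_preimage.
rewrite (_ : rV_uncons \o rV_cons = id); last first.
  by apply/funext => p; exact: rV_consK.
rewrite preimage_id product_measure1E//.
by rewrite lte_mul_pinfty// ge0_fin_numE.
Qed.

HB.instance Definition _ := Measure_isSigmaFinite.Build _ _ _
  lebesgue_rV_succ lebesgue_rV_succ_sigma_finite.

End lebesgue_rV_succ.

Fixpoint lebesgue_rV (R : realType) (n : nat) :
    {sigma_finite_measure set 'rV[R]_n -> \bar R} :=
  if n is m.+1 then lebesgue_rV_succ (lebesgue_rV R m)
  else dirac (0 : 'rV[R]_0).

Lemma lebesgue_rV_box (R : realType) (n : nat) (a b : 'rV[R]_n) :
  (forall i, a 0 i <= b 0 i) ->
  lebesgue_rV R n [set x | forall i, a 0 i <= x 0 i <= b 0 i] =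
  (\prod_i (b 0 i - a 0 i))%:E.
Proof.
elim: n a b => [|n IHn] a b ab.
  by rewrite /= diracE mem_set ?big_ord0// => -[].
rewrite big_ord_recl EFinM.
pose a' : 'rV[R]_n := \row_j a 0 (lift ord0 j).
pose b' : 'rV[R]_n := \row_j b 0 (lift ord0 j).
have boxE : rV_cons (n := n) @^-1` [set x | forall i, a 0 i <= x 0 i <= b 0 i] =
    `[a 0 ord0, b 0 ord0] `*` [set x : 'rV[R]_n | forall i, a' 0 i <= x 0 i <= b' 0 i].
  apply/seteqP; split=> [[x v] /= Bxv|[x v] /= [xab vab] i].
    split; first by have := Bxv ord0; rewrite mxE unlift_none in_itv.
    by move=> j; have := Bxv (lift ord0 j); rewrite !mxE liftK.
  rewrite mxE; case: (unliftP ord0 i) => [j|] -> /=.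
    by have := vab j; rewrite !mxE.
  by move: xab; rewrite in_itv.
have mB : measurable [set x : 'rV[R]_n | forall i, a' 0 i <= x 0 i <= b' 0 i].
  rewrite [X in measurable X](_ : _ =
      \bigcap_(i in [set: 'I_n]) (@rV_coord R n i @^-1` `[a' 0 i, b' 0 i])).
    apply: fin_bigcap_measurable => [|i _]; first exact: finite_finset.
    rewrite -[X in measurable X]setTI.
    exact: (measurable_rV_coord i _ (measurable_itv _)).
  apply/seteqP; split=> [x xab i _|x xab i] /=.
    by rewrite in_itv; exact: xab.
  by have := xab i I; rewrite /= in_itv.
transitivity (((@lebesgue_measure R) \x lebesgue_rV R n)%E
    (rV_cons (n := n) @^-1` [set x | forall i, a 0 i <= x 0 i <= b 0 i])) => //.
rewrite boxE product_measure1E//.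
rewrite IHn => [|j]; last by rewrite !mxE.
congr (_ * _)%E; last by congr EFin; apply: eq_bigr => j _; rewrite !mxE.
rewrite -[LHS]/(lebesgue_measure `[a 0 ord0, b 0 ord0]%classic).
rewrite lebesgue_measure_itv/= lte_fin.
by case: ltgtP (ab ord0) => // ->; rewrite subrr.
Qed.

Section euclidean.
Context (R : realType) (d : nat).
Local Notation E := 'rV[R]_d.
Implicit Types (x y u : E).

Definition dotp x y : R := \sum_i x 0 i * y 0 i.

(* The library norm `|x| on 'rV[R]_d is the sup norm; this is the 2-norm. *)
Definition enorm x : R := Num.sqrt (dotp x x).

(* Near each boundary point p, in rotated coordinates whose last axis is the
   unit vector u, Omega is the strict epigraph of a Lipschitz function gamma of
   the remaining coordinates x - <x, u> u. *)
Definition lipschitz_boundary (Omega : set E) : Prop :=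
  forall p : E, (closure Omega `\` interior Omega) p ->
  exists (u : E) (gamma : E -> R),
    [/\ enorm u = 1,
        exists L : R, forall x y, `|gamma x - gamma y| <= L * enorm (x - y)
      & \forall x \near p,
          Omega x <-> gamma (x - dotp x u *: u) < dotp x u].

Definition bounded_lipschitz_domain (Omega : set E) : Prop :=
  [/\ open Omega, connected Omega, Omega !=set0, bounded_set Omega
    & lipschitz_boundary Omega].

(* The sup is taken in [0, +oo], so that it is 0 when C is empty; the inf over
   an empty X is +oo. *)
Definition fill_distance (X C : set E) : \bar R :=
  maxe 0%E (ereal_sup [set ereal_inf [set (enorm (x - z))%:E | z in X] | x in C]).

End euclidean.

Section differentiation.
Context (R : realType) (d : nat).
Local Notation E := 'rV[R]_d.

Definition pderiv (i : 'I_d) (g : E -> R) : E -> R :=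
  fun x => 'D_(delta_mx 0 i) g x.

Definition gradient (g : E -> R) (x : E) : E := \row_i pderiv i g x.

Definition orbital_derivative (f : E -> E) (V : E -> R) (x : E) : R :=
  dotp (gradient V x) (f x).

Definition mderiv (beta : 'I_d -> nat) (g : E -> R) : E -> R :=
  foldr (fun i h => iter (beta i) (pderiv i) h) g (enum 'I_d).

Fixpoint class_C (k : nat) (U : set E) (g : E -> R) : Prop :=
  (forall x, U x -> {for x, continuous g}) /\
  (if k is k'.+1 then
     forall i, (forall x, U x -> derivable g x (delta_mx 0 i)) /\
               class_C k' U (pderiv i g)
   else True).

Definition locally_hoelder (gamma : R) (U : set E) (g : E -> R) : Prop :=
  forall x, U x -> exists L : R, \forall y \near x & z \near x,
    `|g y - g z| <= L * enorm (y - z) `^ gamma.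

(* C^s for real s >= 0: continuous derivatives up to order floor s, those of
   order floor s being locally Hoelder with exponent s - floor s. For integer s
   this exponent is 0 and the second condition is just local boundedness, which
   continuity implies. *)
Definition class_Cr (s : R) (U : set E) (g : E -> R) : Prop :=
  class_C (Num.truncn s) U g /\
  forall beta : {ffun 'I_d -> 'I_(Num.truncn s).+1},
    (\sum_i beta i)%N = Num.truncn s ->
    locally_hoelder (s - (Num.truncn s)%:R) U (mderiv (fun i => beta i) g).

Definition vfield_class_Cr (s : R) (U : set E) (f : E -> E) : Prop :=
  forall j, class_Cr s U (fun x => f x 0 j).

End differentiation.

Section sobolev.
Context (R : realType) (d : nat) (Omega : set 'rV[R]_d).
Local Notation E := 'rV[R]_d.
Local Notation lambda := (lebesgue_rV R d).

Definition test_function (phi : E -> R) : Prop :=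
  (forall k, class_C k setT phi) /\
  exists K : set E, [/\ compact K, K `<=` Omega & forall x, ~ K x -> phi x = 0].

Definition locally_integrable_on (u : E -> R) : Prop :=
  forall K : set E, compact K -> K `<=` Omega -> lambda.-integrable K (EFin \o u).

Definition weak_derivative (beta : 'I_d -> nat) (u g : E -> R) : Prop :=
  [/\ locally_integrable_on u, locally_integrable_on g
    & forall phi, test_function phi ->
      \int[lambda]_(x in Omega) (u x * mderiv beta phi x) =
      (-1) ^+ (\sum_i beta i) * \int[lambda]_(x in Omega) (g x * phi x)].

(* The norm of W^{m,2}(Omega), with value +oo outside this space. Weak
   derivatives are unique up to a null set, so each infimum is the squared L^2
   norm of the weak derivative, or +oo if there is none. *)
Definition sobolev_int_norm (m : nat) (u : E -> R) : \bar R :=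
  ((\sum_(beta : {ffun 'I_d -> 'I_m.+1} | (\sum_i beta i <= m)%N)
      ereal_inf [set \int[lambda]_(x in Omega) ((g x) ^+ 2)%:E
                | g in weak_derivative (fun i => beta i) u]) `^ 2^-1)%E.

Definition K_functional (m : nat) (u : E -> R) (t : R) : \bar R :=
  ereal_inf [set (sobolev_int_norm m (u \- v)%R
                  + t%:E * sobolev_int_norm m.+1 v)%E | v in [set: E -> R]].

(* The norm of H^alpha(Omega) = W^{alpha,2}(Omega), +oo outside this space: for
   alpha = m + theta with 0 < theta < 1, that of the real interpolation space
   [W^{m,2}(Omega), W^{m+1,2}(Omega)]_{theta,2}. *)
Definition sobolev_norm (alpha : R) (u : E -> R) : \bar R :=
  let m := Num.truncn alpha in
  let theta := alpha - m%:R in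
  if theta == 0 then sobolev_int_norm m u
  else ((\int[lebesgue_measure]_(t in `]0%R, +oo[)
          ((t `^ (- (2 * theta + 1)))%:E * K_functional m u t ^+ 2)) `^ 2^-1)%E.

End sobolev.

Section kernel_space.
Context (R : realType) (d : nat).
Local Notation E := 'rV[R]_d.
Local Notation lambda := (lebesgue_rV R d).
Local Open Scope complex_scope.

(* (2 pi)^(-d/2) * \int Phi(x) exp(- i <x, w>) dx *)
Definition fourier (Phi : E -> R) (w : E) : R[i] :=
  let c := (2 * pi) `^ (- (d%:R / 2)) in
  (c * \int[lambda]_x (Phi x * cos (dotp x w)))
  +i* (- (c * \int[lambda]_x (Phi x * sin (dotp x w)))).

(* On R[i], z <= z' means that z' - z is a nonnegative real: the bounds below
   include that the Fourier transform is real valued. *)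
Definition sobolev_kernel_function (alpha : R) (Phi : E -> R) : Prop :=
  [/\ lambda.-integrable setT (EFin \o Phi), continuous Phi
    & exists c1 c2 : R, [/\ 0 < c1, 0 < c2
      & forall w, (c1 * (1 + enorm w ^+ 2) `^ (- alpha))%:C <= fourier Phi w
                  <= (c2 * (1 + enorm w ^+ 2) `^ (- alpha))%:C]].

(* H, with inner product ip and evaluation ev, is the Hilbert space
   H^alpha(Omega) with reproducing kernel Phi (x - y). An element v of H stands
   for the function ev v restricted to Omega: ev v is irrelevant outside. *)
Record sobolev_rkhs (Omega : set E) (alpha : R) (Phi : E -> R)
    (H : completeNormedModType R) (ip : H -> H -> R) (ev : H -> E -> R) : Prop := {
  rkhs_ipC : forall u v, ip u v = ip v u ;
  rkhs_ip_linear : forall (a : R) u v w, ip (a *: u + v) w = a * ip u w + ip v w ;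
  rkhs_ip_norm : forall v, `|v| ^+ 2 = ip v v ;
  rkhs_ev_linear : forall (a : R) u v x, Omega x ->
    ev (a *: u + v) x = a * ev u x + ev v x ;
  rkhs_ev_inj : forall u v, (forall x, Omega x -> ev u x = ev v x) -> u = v ;
  rkhs_carrier : forall g : E -> R,
    (exists v : H, forall x, Omega x -> ev v x = g x) <->
    {within Omega, continuous g} /\ (sobolev_norm Omega alpha g < +oo)%E ;
  rkhs_norm_equiv : exists c C : R, [/\ 0 < c, 0 < C
    & forall v : H, ((c * `|v|)%:E <= sobolev_norm Omega alpha (ev v)
                     <= (C * `|v|)%:E)%E] ;
  rkhs_kernel : forall y, Omega y -> exists ky : H,
    (forall x, Omega x -> ev ky x = Phi (x - y)) /\
    (forall v, ip v ky = ev v y)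
}.

End kernel_space.

Section problem.
Context (R : realType) (d k : nat) (H : completeNormedModType R).
Local Notation E := 'rV[R]_d.

Definition feasible (ev : H -> E -> R) (f : 'I_k -> E -> E) (b : 'I_k -> E -> R)
    (X : 'I_k -> set E) : set H :=
  [set v | forall i x, X i x -> orbital_derivative (f i) (ev v) x <= b i x].

Definition min_norm (A : set H) (v : H) : Prop :=
  A v /\ forall w, A w -> `|v| <= `|w|.

End problem.

(* Main.v *)
Require Import Defs.
From mathcomp Require Import all_boot all_order all_algebra.
From mathcomp Require Import all_classical all_reals all_analysis.
From mathcomp Require Import measurable_realfun ring lra.
From mathcomp Require complex.

(** The constraints of the continuous problem cut out a closed convex set as
    soon as every [v |-> D_i v (x)] is a bounded linear functional, say
    [v |-> ip v (rho i x)]. Passing from finitely many points to all points is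
    harmless as soon as [rho i] is continuous on [C i]: between nearby points
    [D_i v] then changes by at most [|v| |rho i x - rho i z|], uniformly for [v]
    in a bounded subset of [H]. The proof thus has a part on regularity and a
    part on minimisation.

    Regularity. Let [k x] be the reproducing kernel at [x]. By Fourier inversion
    for [Phi], the squared norm of [sum_i a_i (k x_i)] is, up to a constant,
    the integral of [hat Phi (w) |sum_i a_i exp (i <x_i, w>)|^2]. As
    [hat Phi (w)] is of order [(1 + |w|^2)^(- alpha)] and [2 alpha - 4 > d], this
    is at most [K D^2] whenever [|sum_i a_i exp (i <x_i, w>)|] is at most
    [D (1 + |w|^2)] for all [w] ([positive_definite_bound]). The difference
    quotients [q_t x] of [k] at [x] in a coordinate direction are such sums, and
    elementary bounds on [exp] give [|q_t x - q_s x| <= K (|t| + |s|)] and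
    [|q_t x - q_t y| <= K |x - y|] ([kernel_quotient_lipschitz]). Hence [q_t x]
    converges in [H] as [t] tends to 0; the limit represents the partial
    derivative at [x] of every function of [H] and is Lipschitz in [x]
    ([pderiv_representers]). Multiplying by the components of the vector field
    gives [rho] ([orbital_derivative_representer]).

    Only an inequality is wanted from the inversion formula, so no limit under
    the Fourier integral is taken. The convolution of [Phi] with the heat kernel
    equals the integral of [hat Phi] against a Gaussian with values in [0, 1]
    ([gaussian_inversion]: Fubini's theorem and the Fourier transform of a
    Gaussian). The bound on the quadratic form therefore holds for this
    convolution with a constant independent of the width of the heat kernel, and
    the convolution tends to [Phi] pointwise as that width tends to 0
    ([heat_approximation]).

    Minimisation. The point sets [Z n] are not nested, hence neither are the
    feasible sets of the discretised problems. They are replaced by the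
    decreasing sequence of closed convex sets [B p] formed by all [v] such that,
    at every [x] of [C i], each [c >= b i x] bounding all [D_i (veps n) (x)] with
    [n >= p] also bounds [D_i v (x)]. By construction [veps n] lies in [B p] for
    [n >= p]; the fill distances tending to 0 and the continuity of [rho i] and
    [b i] show that the sets [B p] intersect exactly in the feasible set of the
    continuous problem. The parallelogram identity turns asymptotic minimality of
    norms into a Cauchy property, which yields existence, uniqueness and strong
    convergence at once ([min_norm_limit]). *)

Set Implicit Arguments.
Unset Strict Implicit.
Unset Printing Implicit Defensive.

Import Order.TTheory GRing.Theory Num.Theory numFieldNormedType.Exports.

Local Open Scope classical_set_scope.
Local Open Scope ring_scope.

(** * Almost minimal vectors in decreasing convex sets *)

Section inner_product.
Context (R : realType) (H : completeNormedModType R) (ip : H -> H -> R).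
Hypothesis ipC : forall u v, ip u v = ip v u.
Hypothesis ip_lin : forall (a : R) u v w, ip (a *: u + v) w = a * ip u w + ip v w.
Hypothesis ip_norm : forall v, `|v| ^+ 2 = ip v v.

Lemma ip0l w : ip 0 w = 0.
Proof. by have := ip_lin (-1) 0 0 w; rewrite scaler0 addr0; lra. Qed.

Lemma ipDl u v w : ip (u + v) w = ip u w + ip v w.
Proof. by rewrite -[u]scale1r ip_lin mul1r scale1r. Qed.

Lemma ipZl a u w : ip (a *: u) w = a * ip u w.
Proof. by rewrite -[a *: u]addr0 ip_lin ip0l addr0. Qed.

Lemma ipBl u v w : ip (u - v) w = ip u w - ip v w.
Proof. by rewrite ipDl -scaleN1r ipZl mulN1r. Qed.

Lemma ipBr u v w : ip w (u - v) = ip w u - ip w v.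
Proof. by rewrite ipC ipBl !(ipC _ w). Qed.

Lemma ip_suml (I : finType) (a : I -> R) (u : I -> H) w :
  ip (\sum_i a i *: u i) w = \sum_i a i * ip (u i) w.
Proof.
elim/big_rec2: _ => [|i y1 y2 _ IH]; first exact: ip0l.
by rewrite ipDl ipZl IH.
Qed.

Lemma cauchy_schwarz u v : `|ip u v| <= `|u| * `|v|.
Proof.
have [->|v0] := eqVneq v 0; first by rewrite ipC ip0l !normr0 mulr0.
have v2 : 0 < ip v v by rewrite -ip_norm exprn_gt0// normr_gt0.
have h : 0 <= ip v v * ip u u - ip u v ^+ 2.
  have : 0 <= ip (ip v v *: u - ip u v *: v) (ip v v *: u - ip u v *: v).
    by rewrite -ip_norm sqr_ge0.
  rewrite ipBl !ipBr !ipZl !(ipC _ (_ *: _)) !ipZl (ipC v u).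
  rewrite [X in 0 <= X](_ : _ = ip v v * (ip v v * ip u u - ip u v ^+ 2)).
    by rewrite pmulr_rge0.
  by ring.
rewrite -(@ler_pXn2r _ 2)// ?nnegrE ?mulr_ge0// exprMn !ip_norm.
rewrite real_normK ?num_real//; nra.
Qed.

Lemma parallelogram (u v : H) :
  `|u - v| ^+ 2 = 2 * `|u| ^+ 2 + 2 * `|v| ^+ 2 - 4 * `|2^-1 *: (u + v)| ^+ 2.
Proof.
rewrite !ip_norm ipZl (ipC (u + v)) ipZl ipBl !ipBr ipDl !(ipC _ (u + v)) !ipDl.
by rewrite (ipC v u); field.
Qed.


(** The midpoint of [w n] and [w m] lies in [B p] for large [n] and [m], so its
    norm is almost [mu]; as [|w n|] and [|w m|] are at most almost [mu], the
    parallelogram identity forces [w n - w m] to be small. *)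
Lemma near_minimisers_cvg (B : nat -> set H) (w : nat -> H) (mu : R) :
  (forall p u v, B p u -> B p v -> B p (2^-1 *: (u + v))) ->
  (forall p, closed (B p)) ->
  (forall p q, (p <= q)%N -> B q `<=` B p) ->
  (\forall n \near \oo, B n (w n)) ->
  0 <= mu ->
  (forall e, 0 < e -> exists p, forall v, B p v -> mu - e <= `|v|) ->
  (forall e, 0 < e -> \forall n \near \oo, `|w n| <= mu + e) ->
  exists v, [/\ w @ \oo --> v, `|v| <= mu & forall p, B p v].
Proof.
move=> Bconv Bclosed Bdecr Bw mu0 mulb muub.
have wcauchy : cauchy (w @ \oo).
  apply/cauchy_ballP => eta eta0.
  (* If |w n|, |w m| <= mu + e and the midpoint has norm at least mu - e, then
     |w n - w m|^2 is at most 4 (mu + e)^2 - 4 (mu - e)^2 = 16 e mu. *)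
  pose e := Num.min 1 (eta ^+ 2 / (32 * (mu + 1))).
  have e0 : 0 < e.
    by rewrite lt_min ltr01 divr_gt0// ?exprn_gt0// mulr_gt0//; lra.
  have e1 : e <= 1 by rewrite ge_min lexx.
  have ebound : 16 * e * (mu + e) < eta ^+ 2.
    have : e * (32 * (mu + 1)) <= eta ^+ 2.
      by rewrite -ler_pdivlMr ?ge_min ?lexx ?orbT//; lra.
    by nra.
  have [p mup] := mulb _ e0.
  have Bfar : \forall n \near \oo, B p (w n) /\ `|w n| <= mu + e.
    near=> n; split; last by near: n; exact: muub.
    apply: (Bdecr p n); first by near: n; exact: nbhs_infty_ge.
    by near: n; exact: Bw.
  suff close : forall n m, B p (w n) /\ `|w n| <= mu + e ->
      B p (w m) /\ `|w m| <= mu + e -> ball (w n) eta (w m).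
    rewrite near_map2; pose Q := [set n | B p (w n) /\ `|w n| <= mu + e].
    by exists (Q, Q); [split; exact: Bfar|move=> [n m] /= [bn bm]; exact: close].
  move=> n m [Bn wn] [Bm wm].
  rewrite -ball_normE /ball_/= -(@ltr_pXn2r _ 2)// ?nnegrE ?(ltW eta0)//.
  have := mup _ (Bconv _ _ _ Bn Bm).
  rewrite parallelogram; set N := `|_ *: _| => muN.
  have := normr_ge0 (w n); have := normr_ge0 (w m).
  have : 0 <= N by exact: normr_ge0.
  move: muN wn wm; move: `|w n| `|w m| => a b muN wn wm N0 b0 a0.
  have a2 : a ^+ 2 <= (mu + e) ^+ 2 by rewrite ler_pXn2r ?nnegrE//; lra.
  have b2 : b ^+ 2 <= (mu + e) ^+ 2 by rewrite ler_pXn2r ?nnegrE//; lra.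
  have [emu|mue] := leP e mu.
    have N2 : (mu - e) ^+ 2 <= N ^+ 2 by rewrite ler_pXn2r ?nnegrE//; lra.
    by nra.
  by nra.
have /cvg_ex[v wv] : cvg (w @ \oo) by exact/cauchy_cvgP.
exists v; split=> //.
  apply/ler_addgt0Pr => e e0.
  have nwv : `|w n| @[n --> \oo] --> `|v| by exact: cvg_norm.
  by apply: (cvgr_to_le nwv); exact: muub.
move=> p; apply: (closed_cvg (B p) (Bclosed p) _ _ wv).
near=> n; apply: (Bdecr p n); first by near: n; exact: nbhs_infty_ge.
by near: n; exact: Bw.
Unshelve. all: end_near. Qed.

(** The minimal norm [mu] over the intersection is the limit of the minimal norms
    over the sets [B p]: almost minimal vectors of the sets [B p] converge to a
    vector of the intersection, which is then the minimiser. The sequence [w] has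
    the same limit, because its norms are asymptotically at most [mu]. *)
Lemma min_norm_limit (B : nat -> set H) (w : nat -> H) (eps : R) (v0 : H) :
  (forall p u v, B p u -> B p v -> B p (2^-1 *: (u + v))) ->
  (forall p, closed (B p)) ->
  (forall p q, (p <= q)%N -> B q `<=` B p) ->
  (\forall n \near \oo, B n (w n)) ->
  (\bigcap_p B p) v0 ->
  (forall v, (\bigcap_p B p) v ->
     forall n, (0 < n)%N -> `|w n| <= eps / n%:R + `|v|) ->
  exists v, unique (min_norm (\bigcap_p B p)) v /\ w @ \oo --> v.
Proof.
move=> Bconv Bclosed Bdecr Bw Bv0 wub.
pose S p := [set `|v| | v in B p].
have S0 p : S p !=set0 by exists `|v0|; exists v0 => //; exact: Bv0.
have Slb p : has_lbound (S p) by exists 0 => _ [v _ <-].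
have infS p v : B p v -> inf (S p) <= `|v|.
  by move=> Bv; apply: ge_inf => //; exists v.
pose M := range (fun p => inf (S p)).
have Mub v : (\bigcap_p B p) v -> ubound M `|v|.
  by move=> Bv _ [p _ <-]; apply: infS; exact: Bv.
have Msup : has_sup M by split; [exists (inf (S 0%N)); exists 0%N|exists `|v0|; exact: Mub].
pose mu := sup M.
have muS p : inf (S p) <= mu.
  by apply: ub_le_sup; [exact: (proj2 Msup)|exists p].
have mu0 : 0 <= mu.
  by apply: le_trans (muS 0%N); apply: lb_le_inf => // _ [v _ <-].
have mulb e : 0 < e -> exists p, forall v, B p v -> mu - e <= `|v|.
  move=> e0; have [_ [p _ <-] mup] := sup_adherent e0 Msup.
  by exists p => v Bv; rewrite (le_trans (ltW mup))// infS.
have /choice[x xP] n : exists x, B n x /\ `|x| < inf (S n) + n.+1%:R^-1.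
  have e0 : (0 : R) < n.+1%:R^-1 by rewrite invr_gt0.
  have [_ [x Bx <-] xlt] := inf_adherent e0 (conj (S0 n) (Slb n)).
  by exists x.
have [v [_ vmu Bv]] : exists v, [/\ x @ \oo --> v, `|v| <= mu & forall p, B p v].
  apply: (@near_minimisers_cvg B x mu Bconv Bclosed Bdecr _ mu0 mulb _).
    by apply: nearW => n; exact: (xP n).1.
  move=> e e0; near=> n; rewrite (le_trans (ltW (xP n).2))// lerD//.
  by apply/ltW; near: n; exact: (near_infty_natSinv_lt (PosNum e0)).
have Bv' : (\bigcap_p B p) v by move=> p _; exact: Bv.
have vmin u : (\bigcap_p B p) u -> mu <= `|u|.
  by move=> Bu; apply: ge_sup => //; [exact: (proj1 Msup)|exact: Mub].
have vuniq u : (\bigcap_p B p) u -> `|u| <= mu -> u = v.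
  move=> Bu umu; apply/eqP; rewrite -subr_eq0 -normr_eq0 -sqrf_eq0.
  rewrite eq_le sqr_ge0 andbT parallelogram.
  have : mu <= `|2^-1 *: (u + v)|.
    by apply: vmin => p _; apply: Bconv; [exact: Bu|exact: Bv].
  have := normr_ge0 u; have := normr_ge0 v; move: umu vmu.
  by move: `|u| `|v| `|_ *: _| => a b c; nra.
exists v; split.
  split; first by split=> // u Bu; rewrite (le_trans vmu)// vmin.
  by move=> u [Bu umin]; apply/esym/vuniq => //; rewrite (le_trans (umin _ Bv')).
have [u [wu umu Bu]] :
    exists u, [/\ w @ \oo --> u, `|u| <= mu & forall p, B p u].
  apply: (@near_minimisers_cvg B w mu Bconv Bclosed Bdecr Bw mu0 mulb) => e e0.
  have epsn : eps / n%:R @[n --> \oo] --> (0 : R).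
    rewrite -(mulr0 eps); apply: cvgMr.
    by apply/gtr0_cvgV0; [near=> n; rewrite ltr0n; near: n; exact: nbhs_infty_gt|exact: cvgr_idn].
  near=> n; rewrite (le_trans (wub _ Bv' n _))//.
    by near: n; exact: nbhs_infty_gt.
  rewrite addrC lerD//; near: n.
  exact: cvgr_le epsn _ e0.
by rewrite -(vuniq u)// => p _; exact: Bu.
Unshelve. all: end_near. Qed.

End inner_product.

(** * Iterated integrals over row vectors *)

Section lebesgue_rV_integral.
Context (R : realType).
Local Notation mu := (@lebesgue_measure R).
Local Notation lambda := (lebesgue_rV R).
Local Open Scope ereal_scope.

Lemma ge0_integral_rV_succ n (f : 'rV[R]_n.+1 -> \bar R) :
  measurable_fun setT f -> (forall x, 0 <= f x) ->
  \int[lambda n.+1]_x f x = \int[mu]_a \int[lambda n]_v f (rV_cons (a, v)).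
Proof.
move=> mf f0.
rewrite -[LHS]/(\int[pushforward (mu \x lambda n) (@rV_cons R n)]_x f x).
rewrite (ge0_integral_pushforward (@measurable_rV_cons R n))//.
rewrite preimage_setT fubini_tonelli1// => [|x]; last exact: f0.
by apply: measurableT_comp => //; exact: measurable_rV_cons.
Qed.

(** The nonnegative case shows that the absolute value has a finite iterated
    integral, which is what Fubini's theorem asks for. *)
Lemma integral_rV_succ n (f : 'rV[R]_n.+1 -> \bar R) :
  (lambda n.+1).-integrable setT f ->
  \int[lambda n.+1]_x f x = \int[mu]_a \int[lambda n]_v f (rV_cons (a, v)).
Proof.
move=> intf; have mf := measurable_int _ intf.
have mfc : measurable_fun setT (f \o @rV_cons R n).
  by apply: measurableT_comp => //; exact: measurable_rV_cons.
have intfc : (mu \x lambda n).-integrable setT (f \o @rV_cons R n).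
  apply/integrableP; split=> //.
  have /integrableP[_] := intf.
  rewrite ge0_integral_rV_succ//; last exact: measurableT_comp.
  by rewrite fubini_tonelli1//; exact: measurableT_comp.
rewrite -[LHS]/(\int[pushforward (mu \x lambda n) (@rV_cons R n)]_x f x).
rewrite (integral_pushforward (@measurable_rV_cons R n))//.
by rewrite preimage_setT -integral12_prod_meas1.
Qed.

Lemma rV_cons0 n (a : R) (v : 'rV[R]_n) : rV_cons (a, v) 0%R ord0 = a.
Proof. by rewrite mxE unlift_none. Qed.

Lemma rV_consS n (a : R) (v : 'rV[R]_n) i : rV_cons (a, v) 0%R (lift ord0 i) = v 0%R i.
Proof. by rewrite mxE liftK. Qed.

Lemma measurable_coord n (i : 'I_n) :
  measurable_fun setT (fun x : 'rV[R]_n => x 0%R i).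
Proof. exact: measurable_rV_coord. Qed.

Lemma measurable_prod_coord n (h : 'I_n -> R -> R) :
  (forall i, measurable_fun setT (h i)) ->
  measurable_fun setT (fun x : 'rV[R]_n => \prod_i h i (x 0%R i))%R.
Proof.
move=> mh; apply: measurable_prod => i _.
by apply: measurableT_comp => //; exact: measurable_coord.
Qed.

Lemma integral_prod_coord n (h : 'I_n -> R -> R) (c : 'I_n -> R) :
  (forall i, measurable_fun setT (h i)) ->
  (forall i x, 0 <= h i x)%R ->
  (forall i, \int[mu]_x (h i x)%:E = (c i)%:E) ->
  \int[lambda n]_x (\prod_i h i (x 0%R i))%:E = (\prod_i c i)%:E.
Proof.
elim: n h c => [|n IHn] h c mh h0 hc.
  rewrite /= integral_dirac//; last first.
    by apply/measurable_EFinP; exact: measurable_prod_coord.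
  by rewrite diracT mul1e !big_ord0.
rewrite ge0_integral_rV_succ; last 2 first.
- by apply/measurable_EFinP; exact: measurable_prod_coord.
- by move=> x; rewrite lee_fin; apply: prodr_ge0.
rewrite big_ord_recl EFinM -hc.
rewrite -ge0_integralZr//=; last 3 first.
- by apply/measurable_EFinP; exact: mh.
- by move=> x _; rewrite lee_fin.
- rewrite lee_fin; apply: prodr_ge0 => i _; rewrite -lee_fin -hc.
  by apply: integral_ge0 => x _; rewrite lee_fin.
apply: eq_integral => a _.
under eq_integral => v _.
  rewrite big_ord_recl rV_cons0 EFinM; under eq_bigr do rewrite rV_consS; over.
rewrite ge0_integralZl//=.
- by rewrite (IHn (fun i => h (lift ord0 i)) (fun i => c (lift ord0 i))).
- apply/measurable_EFinP.
  exact: (measurable_prod_coord (h := fun i => h (lift ord0 i))).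
- by move=> v _; rewrite lee_fin; apply: prodr_ge0.
- by rewrite lee_fin.
Qed.

Lemma integrable_prod_coord n (h : 'I_n -> R -> R) (c : 'I_n -> R) :
  (forall i, measurable_fun setT (h i)) ->
  (forall i x, 0 <= h i x)%R ->
  (forall i, \int[mu]_x (h i x)%:E = (c i)%:E) ->
  (lambda n).-integrable setT (fun x => (\prod_i h i (x 0%R i))%:E).
Proof.
move=> mh h0 hc; apply/integrableP; split.
  by apply/measurable_EFinP; exact: measurable_prod_coord.
under eq_integral do rewrite gee0_abs ?lee_fin ?prodr_ge0//.
by rewrite (integral_prod_coord mh h0 hc) ltry.
Qed.

End lebesgue_rV_integral.

Section dot_product.
Context (R : realType).

Lemma measurable_dotp n (z : 'rV[R]_n) : measurable_fun setT (fun w => dotp w z).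
Proof.
apply: measurable_sum => i; apply: measurable_funM => //.
exact: measurable_coord.
Qed.

Lemma dotpC n (w z : 'rV[R]_n) : dotp w z = dotp z w.
Proof. by apply: eq_bigr => i _; rewrite mulrC. Qed.

Lemma dotpDl n (u v z : 'rV[R]_n) : dotp (u + v) z = dotp u z + dotp v z.
Proof. by rewrite -big_split; apply: eq_bigr => i _; rewrite mxE mulrDl. Qed.

Lemma dotpZl n a (v z : 'rV[R]_n) : dotp (a *: v) z = a * dotp v z.
Proof. by rewrite mulr_sumr; apply: eq_bigr => i _; rewrite mxE mulrA. Qed.

Lemma dotpBl n (u v z : 'rV[R]_n) : dotp (u - v) z = dotp u z - dotp v z.
Proof. by rewrite dotpDl -scaleN1r dotpZl mulN1r. Qed.

Lemma dotp_rV_cons n (a : R) (v : 'rV[R]_n) (z : 'rV[R]_n.+1) :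
  dotp (rV_cons (a, v)) z = a * z 0 ord0 + dotp v (rV_uncons z).2.
Proof.
rewrite /dotp big_ord_recl rV_cons0; congr +%R.
by apply: eq_bigr => i _; rewrite rV_consS mxE.
Qed.

End dot_product.

(** * The Fourier transform of a Gaussian *)

Section gaussian.
Context (R : realType).
Local Notation mu := (@lebesgue_measure R).

Definition gaussian (a x : R) : R := expR (- (a * x ^+ 2)).

Lemma gaussian_ge0 a x : 0 <= gaussian a x. Proof. exact: expR_ge0. Qed.

Lemma gaussian_le1 a x : 0 <= a -> gaussian a x <= 1.
Proof. by move=> a0; rewrite -[leRHS]expR0 ler_expR oppr_le0 mulr_ge0 ?sqr_ge0. Qed.

Lemma is_derive_gaussian (a x : R) :
  is_derive x 1 (gaussian a) (- (2 * a * x) * gaussian a x).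
Proof.
rewrite /gaussian.
apply: (@is_derive_eq _ _ _ _ _ _ _ (expR (- (a * x ^+ 2)) * (- (a * (2 * x))))).
  apply: (@is_derive1_comp _ expR (fun x => - (a * x ^+ 2))).
  apply: is_deriveN; apply: is_deriveZ.
  by apply: (is_derive_eq (is_deriveX 2 (is_derive_id _ _))); rewrite /GRing.scale/=; ring.
by ring.
Qed.

Lemma continuous_gaussian (a : R) : continuous (gaussian a).
Proof.
move=> x; apply: differentiable_continuous; apply/derivable1_diffP.
by have [] := is_derive_gaussian a x.
Qed.

Lemma measurable_gaussian (a : R) : measurable_fun setT (gaussian a).
Proof. by apply: continuous_measurable_fun; exact: continuous_gaussian. Qed.

Lemma integral_gaussian (u m : R) : 0 < u ->
  (\int[mu]_x (gaussian u (x - m))%:E = (Num.sqrt (pi / u))%:E)%E.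
Proof.
move=> u0; pose s := Num.sqrt ((2 * u)^-1).
have s0 : s != 0 by rewrite gt_eqF// sqrtr_gt0 invr_gt0 mulr_gt0.
have s2 : s ^+ 2 = (2 * u)^-1 by rewrite sqr_sqrtr// invr_ge0 mulr_ge0// ltW.
have peakE : normal_peak s = (Num.sqrt (pi / u))^-1.
  rewrite /normal_peak s2; congr (_ ^-1); congr Num.sqrt.
  by rewrite -mulr_natr; field; lra.
have pu0 : 0 < Num.sqrt (pi / u) by rewrite sqrtr_gt0 divr_gt0// pi_gt0.
have gE x : gaussian u (x - m) = Num.sqrt (pi / u) * normal_pdf m s x.
  rewrite normal_pdfE// peakE mulrA divff ?gt_eqF// mul1r.
  rewrite /gaussian /normal_fun s2; congr expR.
  by rewrite -mulr_natr; field; lra.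
under eq_integral do rewrite gE EFinM.
rewrite ge0_integralZl//=.
- by rewrite integral_normal_pdf mule1.
- by apply/measurable_EFinP; exact: measurable_normal_pdf.
- by move=> x _; rewrite lee_fin normal_pdf_ge0.
Qed.

Lemma integrable_gaussian (a : R) : 0 < a -> mu.-integrable setT (EFin \o gaussian a).
Proof.
move=> a0; apply/integrableP; split.
  by apply/measurable_EFinP; exact: measurable_gaussian.
under eq_integral do rewrite gee0_abs ?lee_fin ?gaussian_ge0//.
rewrite [ltLHS](_ : _ = (Num.sqrt (pi / a))%:E) ?ltry//.
by rewrite -(integral_gaussian 0 a0); apply: eq_integral => x _; rewrite subr0.
Qed.

(** Half of the Gaussian absorbs the factor [|x|], by [exp y >= 1 + y]; this
    dominates the derivative of the Fourier integral. *)
Lemma gaussian_moment1_le a x : 0 < a ->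
  `|x| * gaussian a x <= (1 + 2 / a) * gaussian (a / 2) x.
Proof.
move=> a0.
have -> : gaussian a x = gaussian (a / 2) x * gaussian (a / 2) x.
  by rewrite /gaussian -expRD; congr expR; field.
rewrite mulrA ler_pM2r ?expR_gt0// /gaussian expRN ler_pdivrMr ?expR_gt0//.
apply: (@le_trans _ _ ((1 + 2 / a) * (1 + a / 2 * x ^+ 2))); last first.
  by rewrite ler_pM2l ?expR_ge1Dx// addr_gt0// divr_gt0.
have -> : (1 + 2 / a) * (1 + a / 2 * x ^+ 2) = 1 + x ^+ 2 + 2 / a + a / 2 * x ^+ 2.
  by field; lra.
have : 0 <= 2 / a by rewrite divr_ge0// ltW.
have : 0 <= a / 2 * x ^+ 2 by rewrite mulr_ge0 ?sqr_ge0// divr_ge0// ltW.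
by rewrite -(real_normK (num_real x)); nra.
Qed.

(** Integrate over [[-n, n]] and let [n] tend to infinity: the boundary terms
    vanish, and the integrals converge by domination. *)
Lemma Rintegral_derivative0 (f F : R -> R) :
  continuous f -> (forall x : R, is_derive x 1 F (f x)) ->
  mu.-integrable setT (EFin \o f) ->
  F n%:R @[n --> \oo] --> (0 : R) -> F (- n%:R) @[n --> \oo] --> (0 : R) ->
  \int[mu]_x f x = 0.
Proof.
move=> cf dF intf F0 F1.
have mf : measurable_fun setT f by exact: continuous_measurable_fun.
have FTC n : (0 < n)%N ->
    \int[mu]_(x in `[- n%:R, n%:R]) f x = F n%:R - F (- n%:R).
  move=> n0; rewrite /Rintegral (@continuous_FTC2 _ f F).
  - by [].
  - by rewrite gtrN ?ltr0n.
  - exact: continuous_subspaceT.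
  - have cF x : {for x, continuous F}.
      by apply: differentiable_continuous; apply/derivable1_diffP; case: (dF x).
    split; first by move=> x _; case: (dF x).
    + by apply: cvg_at_right_filter; exact: cF.
    + by apply: cvg_at_left_filter; exact: cF.
  - by move=> x _; rewrite derive1E; case: (dF x).
pose g n x := (f x * \1_(`[- n%:R, n%:R]%classic : set R) x)%:E.
have gE n x : g n x = (EFin \o (f \_ `[- n%:R, n%:R])) x.
  by rewrite /g /= patchE indicE; case: ifPn; rewrite ?mulr1 ?mulr0.
have [] := @dominated_convergence _ _ _ mu setT measurableT
  g (EFin \o f) (EFin \o (fun x => `|f x|)).
- by move=> n; apply/measurable_EFinP; apply: measurable_funM => //; exact: measurable_indic.
- exact/measurable_EFinP.
- apply: aeW => x _; apply: cvg_near_cst; near=> n.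
  rewrite /g indicE mem_set ?mulr1//= in_itv/= -ler_norml.
  by near: n; exact: nbhs_infty_ger.
- exact: integrable_abse intf.
- apply: aeW => x n _; rewrite /g/= lee_fin normrM ler_piMr//.
  by rewrite indicE; case: (_ \in _); rewrite ?normr1 ?normr0.
move=> _ _ cvgI.
have intfE : (\int[mu]_x (f x)%:E)%E = (\int[mu]_x f x)%:E.
  by rewrite /Rintegral fineK// integrable_fin_num.
rewrite /= intfE in cvgI.
have cvgI' := fine_cvg cvgI.
have cvg0 : F n%:R - F (- n%:R) @[n --> \oo] --> (0 : R).
  by rewrite -[0 : R]subr0; exact: cvgB.
have <- := cvg_lim (@Rhausdorff R) (cvgI' _); apply/cvg_lim => //; apply: cvg_trans cvg0.
apply: near_eq_cvg; near=> n.
rewrite /= -FTC; last by near: n; exact: nbhs_infty_gt.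
rewrite Rintegral_mkcond /Rintegral; congr fine.
by apply: eq_integral => x _; exact/esym/gE.
Unshelve. all: end_near. Qed.

Section gaussian_cosine.
Variables (a th : R).
Hypothesis a0 : 0 < a.

Let f (z w : R) := gaussian a w * cos (z * w + th).
Let h (z w : R) := gaussian a w * sin (z * w + th).

Let is_derive_arg (z w : R) : is_derive w 1 (fun w => z * w + th) z.
Proof.
pose l : R -> R := z \*: id; pose g : R -> R := l + cst th.
have dg : is_derive w (1 : R) g (z *: 1 + 0) by typeclasses eauto.
apply: (is_derive_eq dg).
by rewrite addr0 /GRing.scale/= mulr1.
Qed.

Let is_derive_fz (z w : R) : is_derive z 1 (f ^~ w) (- (w * h z w)).
Proof.
apply: (@is_derive_eq _ _ _ _ _ _ _ (gaussian a w *: (- sin (z * w + th) * w))).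
  apply: is_deriveZ; apply: (@is_derive1_comp _ cos (fun z => z * w + th)).
  rewrite (_ : (fun _ => _) = (fun z => w * z + th)); first exact: is_derive_arg.
  by apply/funext => x; rewrite mulrC.
by rewrite /h /GRing.scale/=; ring.
Qed.

Let is_derive_hw (z w : R) :
  is_derive w 1 (h z) (- (2 * a) * (w * h z w) + z * f z w).
Proof.
apply: (@is_derive_eq _ _ _ _ _ _ _
   (gaussian a w *: (cos (z * w + th) * z) +
    sin (z * w + th) *: (- (2 * a * w) * gaussian a w))).
  apply: is_deriveM; first exact: is_derive_gaussian.
  exact: (@is_derive1_comp _ sin (fun w => z * w + th)).
by rewrite /f /h /GRing.scale/=; ring.
Qed.

Let continuous_arg (z : R) : continuous (fun w : R => z * w + th).
Proof.
move=> w; apply: differentiable_continuous; apply/derivable1_diffP.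
by case: (is_derive_arg z w).
Qed.

Let continuous_f z : continuous (f z).
Proof.
move=> w; apply: cvgM; first exact: continuous_gaussian.
by apply: continuous_comp; [exact: continuous_arg|exact: continuous_cos].
Qed.

Let continuous_h z : continuous (h z).
Proof.
move=> w; apply: cvgM; first exact: continuous_gaussian.
by apply: continuous_comp; [exact: continuous_arg|exact: continuous_sin].
Qed.

Let measurable_f z : measurable_fun setT (f z).
Proof. by apply: continuous_measurable_fun; exact: continuous_f. Qed.

Let measurable_h z : measurable_fun setT (h z).
Proof. by apply: continuous_measurable_fun; exact: continuous_h. Qed.

Let normf_le z w : `|f z w| <= gaussian a w.
Proof.
by rewrite normrM ger0_norm ?gaussian_ge0// ler_piMr ?gaussian_ge0// cos_max.
Qed.

Let normh_le z w : `|h z w| <= gaussian a w.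
Proof.
by rewrite normrM ger0_norm ?gaussian_ge0// ler_piMr ?gaussian_ge0// sin_max.
Qed.

Let integrable_f z : mu.-integrable setT (EFin \o f z).
Proof.
apply: (le_integrable measurableT _ _ (integrable_gaussian a0)).
  by apply/measurable_EFinP; exact: measurable_f.
by move=> w _; rewrite /= lee_fin [leRHS]ger0_norm ?gaussian_ge0.
Qed.

Let integrable_moment1 : mu.-integrable setT (EFin \o (fun w => `|w| * gaussian a w)).
Proof.
have int2 : mu.-integrable setT (EFin \o gaussian (a / 2)).
  by apply: integrable_gaussian; rewrite divr_gt0.
have := integrableZl measurableT (1 + 2 / a) int2.
apply: le_integrable => //.
  apply/measurable_EFinP/measurable_funM; last exact: measurable_gaussian.
  exact: normr_measurable.
move=> w _; rewrite /= lee_fin ger0_norm ?mulr_ge0 ?gaussian_ge0//.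
by rewrite (le_trans (gaussian_moment1_le w a0))// ler_norm.
Qed.

Let integrable_wh z : mu.-integrable setT (EFin \o (fun w => w * h z w)).
Proof.
apply: (le_integrable measurableT _ _ integrable_moment1).
  apply/measurable_EFinP/measurable_funM => //.
  exact: measurable_h.
move=> w _; rewrite /= lee_fin [leRHS]ger0_norm ?mulr_ge0 ?gaussian_ge0//.
by rewrite normrM ler_wpM2l.
Qed.

Let F z := \int[mu]_w f z w.
Let S z := \int[mu]_w (w * h z w).

Let gaussian_cvg0 : gaussian a n%:R @[n --> \oo] --> (0 : R).
Proof.
have an0 : (a * n%:R)^-1 @[n --> \oo] --> (0 : R).
  apply/gtr0_cvgV0.
    by near=> n; rewrite mulr_gt0// ltr0n; near: n; exact: nbhs_infty_gt.
  apply/cvgryPge => A; near=> n; rewrite mulrC -ler_pdivrMr//.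
  by near: n; exact: nbhs_infty_ger.
apply: (squeeze_cvgr _ (cvg_cst 0) an0); near=> n.
have n1 : (1 : R) <= n%:R by rewrite ler1n; near: n; exact: nbhs_infty_gt.
rewrite gaussian_ge0/= /gaussian expRN lef_pV2 ?posrE ?expR_gt0//; last first.
  by rewrite mulr_gt0// (lt_le_trans ltr01).
rewrite (le_trans _ (expR_ge1Dx _))// ler_wpDl// ler_pM2l// expr2.
by rewrite ler_peMl// (le_trans ler01).
Unshelve. all: end_near. Qed.

(** The derivative in [w] of [gaussian a w * sin (z w + th)] integrates to 0. *)
Let by_parts z : 2 * a * S z = z * F z.
Proof.
have gE w : - (2 * a) * (w * h z w) + z * f z w =
  z * f z w - (2 * a) * (w * h z w) by ring.
have intl : mu.-integrable setT (EFin \o (fun w => z * f z w)).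
  exact: (integrableZl measurableT z (integrable_f z)).
have intr : mu.-integrable setT (EFin \o (fun w => 2 * a * (w * h z w))).
  exact: (integrableZl measurableT (2 * a) (integrable_wh z)).
have hcvg (e : nat -> R) : (forall n, e n ^+ 2 = n%:R ^+ 2) ->
    h z (e n) @[n --> \oo] --> (0 : R).
  move=> e2; apply: norm_cvg0; apply: (squeeze_cvgr _ (cvg_cst 0) gaussian_cvg0).
  apply: nearW => n; rewrite normr_ge0/= (le_trans (normh_le _ _))//.
  by rewrite /gaussian e2.
have : \int[mu]_w (- (2 * a) * (w * h z w) + z * f z w) = 0.
  apply: (@Rintegral_derivative0 _ (h z)).
  - move=> w; apply: cvgD; apply: cvgM; [exact: cvg_cst| |exact: cvg_cst|exact: continuous_f].
    by apply: cvgM; [exact: cvg_id|exact: continuous_h].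
  - by move=> w; exact: is_derive_hw.
  - rewrite (_ : EFin \o _ = fun w => ((z * f z w)%:E - (2 * a * (w * h z w))%:E)%E).
      exact: integrableB.
    by apply/funext => w /=; rewrite gE.
  - exact: hcvg.
  - by apply: hcvg => n; rewrite sqrrN.
under eq_Rintegral do rewrite gE.
rewrite RintegralB// !RintegralZl//.
by move/subr0_eq => <-.
Qed.

Let is_derive_F (z : R) : is_derive z 1 F (- S z).
Proof.
have d1E x y : partial1of2 f x y = - (y * h x y).
  by rewrite partial1of2E; case: (is_derive_fz x y).
have zI : `]z - 1, z + 1[%classic z by rewrite /= in_itv/= ltrBlDr ltrDl ltr01.
have dfz (x y : R) : derivable (f ^~ y) x 1 by case: (is_derive_fz x y).
have cvgF := @cvg_differentiation_under_integral R _ _ mu f setT measurableT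
  z (z - 1) (z + 1) zI (fun x _ => integrable_f x)
  (fun x y _ _ => dfz x y) (fun w => `|w| * gaussian a w).
have -> : - S z = \int[mu]_(y in setT) partial1of2 f z y.
  rewrite (@eq_Rintegral _ _ _ mu setT (fun y : R => (-1) * (y * h z y))); last first.
    by move=> y _; rewrite d1E mulN1r.
  by rewrite RintegralZl// mulN1r.
suff FF : h^-1 *: (F (h + z) - F z) @[h --> 0^'] -->
    \int[mu]_(y in setT) partial1of2 f z y.
  apply: DeriveDef.
    by apply/cvg_ex; eexists; under eq_fun do rewrite scaler1; exact: FF.
  by apply/cvg_lim => //; under eq_fun do rewrite scaler1; exact: FF.
apply: cvgF => //.
- by move=> y; rewrite mulr_ge0// gaussian_ge0.
- by move=> x y _ _; rewrite d1E normrN normrM ler_wpM2l.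
Qed.

Lemma integrable_gaussian_cos z :
  mu.-integrable setT (EFin \o (fun w => gaussian a w * cos (z * w + th))).
Proof. exact: integrable_f. Qed.

(** As a function of [z], the integral [F] satisfies [F' = - z / (2 a) F], by
    differentiation under the integral and integration by parts. So
    [F z * exp (z^2 / (4 a))] is constant. The phase [th] is what makes the
    induction on the dimension go through for products: the inner integral
    absorbs the other variables as a phase. *)
Lemma Rintegral_gaussian_cos z :
  \int[mu]_w (gaussian a w * cos (z * w + th)) =
  cos th * (Num.sqrt (pi / a) * gaussian (4 * a)^-1 z).
Proof.
have an0 : a != 0 by rewrite gt_eqF.
pose K x := expR ((4 * a)^-1 * x ^+ 2).
have dK (x : R) : is_derive x 1 K (x / (2 * a) * K x).
  rewrite [K](_ : _ = gaussian (- (4 * a)^-1)); last first.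
    by apply/funext => y; rewrite /K /gaussian mulNr opprK.
  apply: is_derive_eq (is_derive_gaussian _ _) _.
  by rewrite /GRing.scale/=; field.
have dFK (x : R) : is_derive x 1 (F * K) 0.
  apply: is_derive_eq (is_deriveM (is_derive_F x) (dK x)) _.
  rewrite /GRing.scale/=; have := by_parts x => bp.
  have -> : S x = x * F x / (2 * a) by rewrite -bp; field.
  by field.
have FK : F z * K z = F 0 * K 0 := is_derive_0_is_cst z 0 dFK.
have K0 : K 0 = 1 by rewrite /K expr0n mulr0 expR0.
have F0 : F 0 = cos th * Num.sqrt (pi / a).
  rewrite /F /f; under eq_Rintegral do rewrite mul0r add0r mulrC.
  rewrite RintegralZl//; last exact: integrable_gaussian.
  congr (_ * _); rewrite /Rintegral -[RHS]/(fine (_)%:E).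
  rewrite -(integral_gaussian 0 a0); congr fine.
  by apply: eq_integral => x _; rewrite subr0.
rewrite K0 mulr1 in FK.
rewrite -/(F z) mulrA -F0 -FK /gaussian expRN -/(K z) mulfK//.
by rewrite gt_eqF// expR_gt0.
Qed.

End gaussian_cosine.

End gaussian.

(** * Gaussians and the heat kernel in several variables *)

Section integrals.
Context (R : realType).
Local Notation mu := (@lebesgue_measure R).
Local Notation lambda := (lebesgue_rV R).

Lemma EFin_Rintegral d (T : measurableType d) (m : {measure set T -> \bar R})
    (f : T -> R) : m.-integrable setT (EFin \o f) ->
  (\int[m]_x (f x)%:E)%E = (\int[m]_x f x)%:E.
Proof. by move=> intf; rewrite /Rintegral fineK// integrable_fin_num. Qed.

Definition gaussian_rV n (a : R) (w : 'rV[R]_n) : R := \prod_i gaussian a (w 0 i).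

(** The density of [n] independent centred normal variables of variance
    [1 / (2 u)]; it concentrates at 0 as [u] tends to infinity. *)
Definition heat n (u : R) (z : 'rV[R]_n) : R :=
  \prod_i (Num.sqrt (u / pi) * gaussian u (z 0 i)).

Lemma gaussian_rV_ge0 n a (w : 'rV[R]_n) : 0 <= gaussian_rV a w.
Proof. by apply: prodr_ge0 => i _; exact: gaussian_ge0. Qed.

Lemma gaussian_rV_le1 n a (w : 'rV[R]_n) : 0 <= a -> gaussian_rV a w <= 1.
Proof.
move=> a0; rewrite [leRHS](_ : 1 = \prod_(i < n) 1); last by rewrite big1.
apply: ler_prod => i _.
by rewrite gaussian_ge0 gaussian_le1.
Qed.

Lemma heat_ge0 n u (w : 'rV[R]_n) : 0 <= heat u w.
Proof. by apply: prodr_ge0 => i _; rewrite mulr_ge0 ?gaussian_ge0. Qed.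

Lemma measurable_gaussian_rV n (a : R) :
  measurable_fun setT (@gaussian_rV n a).
Proof.
apply: (measurable_prod_coord (h := fun=> gaussian a)) => i.
exact: measurable_gaussian.
Qed.

Lemma integral_gaussian0 (a : R) : 0 < a ->
  (\int[mu]_x (gaussian a x)%:E = (Num.sqrt (pi / a))%:E)%E.
Proof.
move=> a0; rewrite -(integral_gaussian 0 a0).
by apply: eq_integral => x _; rewrite subr0.
Qed.

Lemma integrable_gaussian_rV n (a : R) : 0 < a ->
  (lambda n).-integrable setT (EFin \o @gaussian_rV n a).
Proof.
move=> a0; apply: (@integrable_prod_coord _ _ (fun=> gaussian a) (fun=> Num.sqrt (pi / a))).
- by move=> i; exact: measurable_gaussian.
- by move=> i x; exact: gaussian_ge0.
- by move=> i; exact: integral_gaussian0.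
Qed.

Lemma measurable_heat n (u : R) (m : 'rV[R]_n) :
  measurable_fun setT (fun x : 'rV[R]_n => heat u (x - m)).
Proof.
rewrite [X in measurable_fun _ X](_ : _ = fun x : 'rV[R]_n =>
  \prod_i (Num.sqrt (u / pi) * gaussian u (x 0 i - m 0 i))); last first.
  by apply/funext => x; apply: eq_bigr => i _; rewrite !mxE.
apply: (@measurable_prod_coord _ _ (fun i y => Num.sqrt (u / pi) * gaussian u (y - m 0 i))).
move=> i; apply: measurable_funM => //.
by apply: measurableT_comp; [exact: measurable_gaussian|exact: measurable_funB].
Qed.

Let integral_heat1 (u : R) (m : R) : 0 < u ->
  (\int[mu]_x (Num.sqrt (u / pi) * gaussian u (x - m))%:E = 1%:E)%E.
Proof.
move=> u0; under eq_integral do rewrite EFinM.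
rewrite ge0_integralZl//=; last 2 first.
- apply/measurable_EFinP; apply: measurableT_comp; first exact: measurable_gaussian.
  exact: measurable_funB.
- by move=> x _; rewrite lee_fin gaussian_ge0.
rewrite integral_gaussian// -EFinM -sqrtrM ?divr_ge0 ?pi_ge0 ?(ltW u0)//.
have p0 := pi_gt0 R.
by rewrite mulrA divfK ?gt_eqF// divff ?gt_eqF// sqrtr1.
Qed.

Let heatE n (u : R) (m x : 'rV[R]_n) :
  heat u (x - m) = \prod_i (Num.sqrt (u / pi) * gaussian u (x 0 i - m 0 i)).
Proof. by apply: eq_bigr => i _; rewrite !mxE. Qed.

Lemma integrable_heat n (u : R) (m : 'rV[R]_n) : 0 < u ->
  (lambda n).-integrable setT (EFin \o (fun x : 'rV[R]_n => heat u (x - m))).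
Proof.
move=> u0; rewrite (_ : EFin \o _ = fun x : 'rV[R]_n =>
  (\prod_i (Num.sqrt (u / pi) * gaussian u (x 0 i - m 0 i)))%:E); last first.
  by apply/funext => x /=; rewrite heatE.
apply: (@integrable_prod_coord _ _ (fun i y => Num.sqrt (u / pi) * gaussian u (y - m 0 i)) (fun=> 1)).
- move=> i; apply: measurable_funM => //.
  by apply: measurableT_comp; [exact: measurable_gaussian|exact: measurable_funB].
- by move=> i x; rewrite mulr_ge0 ?gaussian_ge0.
- by move=> i; exact: integral_heat1.
Qed.

Lemma Rintegral_heat n (u : R) (m : 'rV[R]_n) : 0 < u ->
  \int[lambda n]_x heat u ((x : 'rV[R]_n) - m) = 1.
Proof.
move=> u0; rewrite /Rintegral.
under eq_integral do rewrite heatE.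
rewrite (@integral_prod_coord _ _ (fun i y => Num.sqrt (u / pi) * gaussian u (y - m 0 i)) (fun=> 1)).
- by rewrite big1.
- move=> i; apply: measurable_funM => //.
  by apply: measurableT_comp; [exact: measurable_gaussian|exact: measurable_funB].
- by move=> i x; rewrite mulr_ge0 ?gaussian_ge0.
- by move=> i; exact: integral_heat1.
Qed.

Lemma integrable_gaussian_rV_cos n (a th : R) (z : 'rV[R]_n) : 0 < a ->
  (lambda n).-integrable setT
    (EFin \o (fun w => gaussian_rV a w * cos (dotp w z + th))).
Proof.
move=> a0; apply: (le_integrable measurableT _ _ (integrable_gaussian_rV n a0)).
  apply/measurable_EFinP/measurable_funM; first exact: measurable_gaussian_rV.
  apply: measurableT_comp.
    by apply: continuous_measurable_fun; exact: continuous_cos.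
  by apply: measurable_funD => //; exact: measurable_dotp.
move=> w _; rewrite /= lee_fin normrM ler_piMr//.
exact: cos_max.
Qed.

(** Integrating out one variable turns the term [a * z 0 ord0] of the dot product
    into a change of phase, so the one-dimensional formula applies in each
    variable. *)
Lemma Rintegral_gaussian_rV_cos n (a th : R) (z : 'rV[R]_n) : 0 < a ->
  \int[lambda n]_w (gaussian_rV a w * cos (dotp w z + th)) =
  cos th * \prod_i (Num.sqrt (pi / a) * gaussian (4 * a)^-1 (z 0 i)).
Proof.
move=> a0; elim: n z th => [|n IHn] z th.
  rewrite /Rintegral /= integral_dirac//.
    by rewrite diracT mul1e /gaussian_rV /dotp !big_ord0 add0r mul1r mulr1.
  by have /integrableP[] := integrable_gaussian_rV_cos th z a0.
rewrite /Rintegral integral_rV_succ; last exact: integrable_gaussian_rV_cos.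
pose P := \prod_i (Num.sqrt (pi / a) * gaussian (4 * a)^-1 ((rV_uncons z).2 0 i)).
have inner (x : R) : (\int[lambda n]_v (gaussian_rV a (rV_cons (x, v)) *
    cos (dotp (rV_cons (x, v)) z + th))%:E =
    (P * (gaussian a x * cos (z 0 ord0 * x + th)))%:E)%E.
  have int1 := integrable_gaussian_rV_cos (z 0 ord0 * x + th) (rV_uncons z).2 a0.
  transitivity ((gaussian a x)%:E * \int[lambda n]_v (gaussian_rV a v *
      cos (dotp v (rV_uncons z).2 + (z 0 ord0 * x + th)))%:E)%E.
    rewrite -integralZl//; apply: eq_integral => v _.
    rewrite -EFinM mulrA; congr EFin; congr (_ * cos _).
      rewrite /gaussian_rV big_ord_recl rV_cons0; congr (_ * _).
      by apply: eq_bigr => i _; rewrite rV_consS.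
    by rewrite dotp_rV_cons; ring.
  by rewrite EFin_Rintegral// IHn -EFinM; congr EFin; rewrite -/P; ring.
under eq_integral do rewrite inner.
rewrite -/(Rintegral mu setT (fun x => P * (gaussian a x * cos (z 0 ord0 * x + th)))).
rewrite RintegralZl//; last first.
  exact: integrable_gaussian_cos.
rewrite Rintegral_gaussian_cos// big_ord_recl mulrCA (mulrC P); congr (_ * (_ * _)).
by apply: eq_bigr => i _; rewrite mxE.
Qed.

End integrals.

(** * Integrability of the Sobolev weight *)

Section decay.
Context (R : realType).
Local Notation mu := (@lebesgue_measure R).
Local Notation lambda := (lebesgue_rV R).

(** The one-dimensional factor of the product that dominates a power of
    [1 + |w|^2]. *)
Definition decay (s t : R) : R := (1 + t ^+ 2) `^ (- s).

Lemma decay_ge0 s t : 0 <= decay s t. Proof. exact: powR_ge0. Qed.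

Lemma one_plus_sqr_gt0 (t : R) : 0 < 1 + t ^+ 2.
Proof. by rewrite ltr_pwDl ?sqr_ge0. Qed.

Lemma continuous_powR_pos (p x : R) : 0 < x -> {for x, continuous (fun y : R => y `^ p)}.
Proof.
move=> x0; apply: differentiable_continuous; apply/derivable1_diffP.
by case: (is_derive1_powR p x0).
Qed.

Lemma continuous_decay s : continuous (decay s).
Proof.
move=> t; suff : {for t, continuous ((fun y : R => y `^ (- s)) \o (fun t : R => 1 + t ^+ 2))} by [].
apply: continuous_comp; last exact/continuous_powR_pos/one_plus_sqr_gt0.
by apply: cvgD; [exact: cvg_cst|exact: sqr_continuous].
Qed.

Lemma measurable_decay s : measurable_fun setT (decay s).
Proof. by apply: continuous_measurable_fun; exact: continuous_decay. Qed.

Lemma powR_decr_cvg0 (q : R) : 0 < q -> (1 + t) `^ (- q) @[t --> +oo] --> (0 : R).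
Proof.
move=> q0; apply/cvgrPdist_le => e e0; near=> t.
have t0 : 0 < t by near: t; exact: nbhs_pinfty_gt.
have et : e `^ (- q^-1) <= 1 + t.
  by rewrite -lerBlDl; near: t; exact: nbhs_pinfty_ge.
rewrite sub0r normrN ger0_norm ?powR_ge0// powRN -[leRHS]invrK lef_pV2 ?posrE.
- rewrite [leLHS](_ : _ = (e `^ (- q^-1)) `^ q).
    by rewrite ge0_ler_powR ?nnegrE ?(ltW q0) ?powR_ge0// ltW// addr_gt0.
  rewrite -powRrM mulNr mulVf ?gt_eqF// powR_inv1// ltW//.
- by rewrite powR_gt0// addr_gt0.
- by rewrite invr_gt0.
Unshelve. all: end_near. Qed.

Lemma integral_powR_decr (p : R) : 1 < p ->
  (\int[mu]_(t in `[0%R, +oo[) ((1 + t) `^ (- p))%:E = ((p - 1)^-1)%:E)%E.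
Proof.
move=> p1; have p10 : 0 < p - 1 by rewrite subr_gt0.
pose F (t : R) : R := - (p - 1)^-1 * (1 + t) `^ (- (p - 1)).
have dF (t : R) : 0 <= t -> is_derive t 1 F ((1 + t) `^ (- p)).
  move=> t0; have t1 : 0 < 1 + t by rewrite ltr_pwDl.
  have d1 : is_derive t (1 : R) (fun t : R => 1 + t) 1.
    have d2 : is_derive t (1 : R) ((cst 1 : R -> R) + id) (0 + 1).
      by apply: is_deriveD.
    by apply: (is_derive_eq d2); rewrite add0r.
  have d3 := @is_derive1_comp _ (fun y : R => y `^ (- (p - 1))) _ _ _ _
    (is_derive1_powR (- (p - 1)) t1) d1.
  have d4 : is_derive t (1 : R) F (- (p - 1)^-1 *:
      (- (p - 1) * (1 + t) `^ (- (p - 1) - 1) * 1)).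
    exact: is_deriveZ.
  apply: (is_derive_eq d4); rewrite /GRing.scale/= mulr1 mulrA mulrNN.
  by rewrite mulVf ?gt_eqF// mul1r; congr (_ `^ _); ring.
have cpow (t : R) : 0 <= t -> {for t, continuous (fun t : R => (1 + t) `^ (- p))}.
  move=> t0.
  suff : {for t, continuous ((fun y : R => y `^ (- p)) \o (fun t : R => 1 + t))} by [].
  apply: continuous_comp; first by apply: cvgD; [exact: cvg_cst|exact: cvg_id].
  by apply: continuous_powR_pos; rewrite ltr_pwDl.
have cF (t : R) : 0 <= t -> {for t, continuous F}.
  move=> t0; apply: differentiable_continuous; apply/derivable1_diffP.
  by case: (dF t t0).
rewrite (@ge0_continuous_FTC2y _ _ F 0 0).
- by rewrite /F addr0 powR1 mulr1 -EFinB sub0r opprK.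
- by move=> t t0; exact: powR_ge0.
- apply/continuous_within_itvcyP; split.
    by move=> t; rewrite in_itv/= andbT => t0; apply: cpow; exact: ltW.
  by apply: cvg_at_right_filter; exact: cpow.
- rewrite -(mulr0 (- (p - 1)^-1)); apply: cvgM; first exact: cvg_cst.
  exact: powR_decr_cvg0.
- by move=> t t0; case: (dF t (ltW t0)).
- by apply: cvg_at_right_filter; exact: cF.
- by move=> t; rewrite in_itv/= andbT => t0; rewrite derive1E; case: (dF t (ltW t0)).
Qed.

(** On the half-line, [1 + t^2 >= (1 + t)^2 / 2] reduces this to an integral with
    an explicit antiderivative. *)
Lemma integrable_decay s : 2^-1 < s -> mu.-integrable setT (EFin \o decay s).
Proof.
move=> s2; apply/integrableP; split.
  by apply/measurable_EFinP; exact: measurable_decay.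
under eq_integral do rewrite gee0_abs ?lee_fin ?decay_ge0//.
rewrite (ge0_symfun_integralT (decay_ge0 s) (@continuous_decay s)); last first.
  by move=> t; rewrite /decay/= sqrrN.
rewrite lte_mul_pinfty// (_ : [set x | (0 <= x)%R] = `[0%R, +oo[%classic); last first.
  by apply/seteqP; split => x /=; rewrite in_itv/= andbT.
have s0 : 0 <= s by rewrite (le_trans _ (ltW s2)).
have p1 : 1 < 2 * s by lra.
apply: (@le_lt_trans _ _ (\int[mu]_(t in `[0%R, +oo[)
    ((2 `^ s)%:E * ((1 + t) `^ (- (2 * s)))%:E))%E).
  apply: ge0_le_integral => //.
  - by move=> t _; rewrite lee_fin decay_ge0.
  - by apply/measurable_EFinP; apply: measurable_funTS; exact: measurable_decay.
  - apply/measurable_EFinP; apply: measurable_funM => //.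
    apply: (measurableT_comp (measurable_powR _)).
    by apply: measurable_funD => //; exact: measurable_id.
  - move=> t; rewrite /= in_itv/= andbT => t0.
    have t1 : 0 <= 1 + t by rewrite addr_ge0.
    rewrite -EFinM lee_fin /decay powRN powRN ler_pdivlMr ?powR_gt0//; last by rewrite ltr_pwDl.
    rewrite mulrC ler_pdivrMr ?powR_gt0 ?one_plus_sqr_gt0//.
    rewrite powRrM powR_mulrn// -powRM//; last by rewrite ltW// one_plus_sqr_gt0.
    rewrite ge0_ler_powR ?nnegrE ?sqr_ge0//.
      by rewrite mulr_ge0// ltW// one_plus_sqr_gt0.
    have := sqr_ge0 (1 - t); nra.
rewrite ge0_integralZl//.
- by rewrite integral_powR_decr// -EFinM ltry.
- apply/measurable_EFinP; apply: (measurableT_comp (measurable_powR _)).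
  by apply: measurable_funD => //; exact: measurable_id.
- by move=> t _; rewrite lee_fin powR_ge0.
Qed.


Lemma integrable_decay_rV n s : 2^-1 < s ->
  (lambda n).-integrable setT
    (EFin \o (fun w : 'rV[R]_n => \prod_i decay s (w 0 i))).
Proof.
move=> s2.
apply: (@integrable_prod_coord _ _ (fun=> decay s) (fun=> \int[mu]_t decay s t)).
- by move=> i; exact: measurable_decay.
- by move=> i x; exact: decay_ge0.
- by move=> i; rewrite EFin_Rintegral//; exact: integrable_decay.
Qed.

Lemma enorm_sqr n (w : 'rV[R]_n) : enorm w ^+ 2 = \sum_i w 0 i ^+ 2.
Proof.
rewrite /enorm sqr_sqrtr; last by apply: sumr_ge0 => i _; rewrite -expr2 sqr_ge0.
by apply: eq_bigr => i _; rewrite expr2.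
Qed.

Lemma coord_sqr_le_enorm n (w : 'rV[R]_n) i : w 0 i ^+ 2 <= enorm w ^+ 2.
Proof.
rewrite enorm_sqr (bigD1 i)//= lerDl; apply: sumr_ge0 => j _.
exact: sqr_ge0.
Qed.

(** Each factor [1 + w_i^2] is at most [1 + |w|^2], so the [n]-th power of
    [1 + |w|^2] is at least their product. This splits a radial weight into a
    product, which is integrable when [beta / n > 1 / 2]. *)
Lemma weight_le_decay n (w : 'rV[R]_n) (beta : R) : (0 < n)%N -> 0 <= beta ->
  (1 + enorm w ^+ 2) `^ (- beta) <= \prod_i decay (beta / n%:R) (w 0 i).
Proof.
move=> n0 beta0.
have w0 : 0 < 1 + enorm w ^+ 2 by exact: one_plus_sqr_gt0.
rewrite (_ : - beta = - (beta / n%:R) * n%:R); last first.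
  by rewrite mulNr divfK// pnatr_eq0 -lt0n.
rewrite powRrM powR_mulrn ?powR_ge0//.
rewrite -[X in _ ^+ X]card_ord -prodr_const; apply: ler_prod => i _.
rewrite powR_ge0/= /decay !powRN lef_pV2 ?posrE ?powR_gt0 ?one_plus_sqr_gt0//.
rewrite ge0_ler_powR ?nnegrE ?divr_ge0 ?(ltW w0) ?(ltW (one_plus_sqr_gt0 _))//.
by rewrite lerD2l coord_sqr_le_enorm.
Qed.

End decay.

(** * The heat kernel as an approximate identity *)

Section approximate_identity.
Context (R : realType) (n : nat).
Local Notation lambda := (lebesgue_rV R n).
Local Notation E := 'rV[R]_n.

Lemma coord_le_norm (z : E) i : `|z 0 i| <= `|z|.
Proof.
rewrite -[leRHS]/(mx_norm z) mx_normrE.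
exact: (le_bigmax _ (fun ij : 'I_1 * 'I_n => `|z ij.1 ij.2|) (0, i)).
Qed.

Lemma norm_le_coord (z : E) (e : R) : 0 <= e -> (forall i, `|z 0 i| <= e) -> `|z| <= e.
Proof.
move=> e0 ze; rewrite -[leLHS]/(mx_norm z) mx_normrE; apply: bigmax_le => // -[i j] _ /=.
by rewrite ord1.
Qed.

Lemma heatE (u : R) (z : E) : heat u z = Num.sqrt (u / pi) ^+ n * gaussian_rV u z.
Proof. by rewrite /heat big_split /= prodr_const card_ord. Qed.

Lemma heat_le (u : R) (z : E) : 0 <= u -> heat u z <= Num.sqrt (u / pi) ^+ n.
Proof.
by move=> u0; rewrite heatE ler_piMr ?exprn_ge0// gaussian_rV_le1.
Qed.

Lemma gaussian_rV_halve (u : R) (z : E) :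
  gaussian_rV u z = gaussian_rV (u / 2) z * gaussian_rV (u / 2) z.
Proof.
rewrite /gaussian_rV -big_split/=; apply: eq_bigr => i _.
by rewrite /gaussian -expRD; congr expR; field.
Qed.

Lemma gaussian_rV_far (u d : R) (z : E) : 0 <= u -> 0 <= d -> d < `|z| ->
  gaussian_rV u z <= expR (- (u * d ^+ 2)).
Proof.
move=> u0 d0 dz.
have [i dzi] : exists i, d < `|z 0 i|.
  apply/not_existsP => zd; have : `|z| <= d.
    by apply: norm_le_coord => // i; rewrite leNgt; apply/negP.
  by rewrite leNgt dz.
rewrite /gaussian_rV (bigD1 i)//= -[leRHS]mulr1.
apply: ler_pM; rewrite ?gaussian_ge0//.
- by apply: prodr_ge0 => j _; exact: gaussian_ge0.
- rewrite ler_expR lerN2 ler_wpM2l// -(real_normK (num_real (z 0 i))).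
  by rewrite ler_pXn2r ?nnegrE// ltW.
- rewrite [leRHS](_ : 1 = \prod_(j < n | j != i) 1); last by rewrite big1.
  by apply: ler_prod => j _; rewrite gaussian_ge0 gaussian_le1.
Qed.

(** A bound for the heat kernel outside the ball of radius [d], both absolutely
    and relative to a wider heat kernel; the factor [u ^+ n] is a crude bound for
    the height of the heat kernel. *)
Definition heat_tail (d u : R) : R := 2 ^+ n * u ^+ n * expR (- (u / 2 * d ^+ 2)).

(** Of the exponent [- u |z|^2], one half is spent on the factor
    [exp (- u d^2 / 2)]; the other half is kept as a heat kernel with parameter
    [u / 2]. The relative bound has an integral, and the absolute one
    can be multiplied by an integrable function. *)
Lemma heat_far (d u : R) (z : E) : 1 <= u -> 0 <= d -> d < `|z| ->
  heat u z <= heat_tail d u /\ heat u z <= heat_tail d u * heat (u / 2) z.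
Proof.
move=> u1 d0 dz; have u0 : 0 <= u by rewrite (le_trans ler01).
have u20 : 0 <= u / 2 by rewrite divr_ge0.
have p1 : 1 <= (pi : R) by rewrite (le_trans _ (pi_ge2 R))// ler1n.
have p0 : 0 < (pi : R) by exact: pi_gt0.
have far := gaussian_rV_far u20 d0 dz.
have gge0 a := gaussian_rV_ge0 a z.
have pn0 : (pi : R) != 0 by rewrite gt_eqF.
have up0 : 0 <= u / pi by rewrite divr_ge0// ltW.
have up20 : 0 <= u / 2 / pi by rewrite divr_ge0// ltW.
have quarter (p : R) : p != 0 -> 2 ^+ 2 * (u / 2 / p) = 2 * (u / p).
  by move=> ?; field.
have half2 : Num.sqrt (u / pi) <= 2 * Num.sqrt (u / 2 / pi).
  rewrite -(@ler_pXn2r _ 2)// ?nnegrE ?mulr_ge0// exprMn !sqr_sqrtr//.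
  rewrite [leRHS](_ : _ = 2 * (u / pi)); last exact: quarter.
  by rewrite ler_peMl// ler1n.
have sqrtu : Num.sqrt (u / pi) <= u.
  rewrite -(@ler_pXn2r _ 2)// ?nnegrE// sqr_sqrtr//.
  by rewrite ler_pdivrMr// expr2 -mulrA ler_peMr// mulr_ege1.
have sqrtun : Num.sqrt (u / pi) ^+ n <= u ^+ n by rewrite lerXn2r ?nnegrE.
split.
  rewrite heatE gaussian_rV_halve /heat_tail mulrA.
  rewrite ler_pM// ?mulr_ge0 ?exprn_ge0//.
  apply: (@le_trans _ _ (u ^+ n)).
    by rewrite -[leRHS]mulr1 ler_pM ?exprn_ge0// gaussian_rV_le1.
  by rewrite ler_peMl ?exprn_ge0// exprn_ege1// ler1n.
rewrite !heatE gaussian_rV_halve /heat_tail.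
rewrite [leRHS](_ : _ = (2 * Num.sqrt (u / 2 / pi)) ^+ n * u ^+ n *
   (expR (- (u / 2 * d ^+ 2)) * gaussian_rV (u / 2) z)); last by rewrite exprMn; ring.
rewrite ler_pM ?exprn_ge0 ?mulr_ge0//; last by rewrite ler_wpM2r.
rewrite -[leLHS]mulr1 ler_pM ?exprn_ge0// ?exprn_ege1//.
by rewrite lerXn2r ?nnegrE// mulr_ge0.
Qed.

Lemma heat_tail_cvg0 (d : R) : 0 < d -> heat_tail d u @[u --> +oo] --> (0 : R).
Proof.
move=> d0; pose kappa := d ^+ 2 / 2.
have k0 : 0 < kappa by rewrite divr_gt0// exprn_gt0.
pose K := 2 ^+ n * (n.+1)`!%:R / kappa ^+ n.+1.
have K0 : 0 <= K.
  by rewrite divr_ge0 ?exprn_ge0 ?mulr_ge0// ltW.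
apply/cvgrPdist_le => e e0; near=> u.
have u0 : 0 < u by near: u; exact: nbhs_pinfty_gt.
rewrite sub0r normrN ger0_norm; last first.
  by rewrite mulr_ge0 ?expR_ge0// mulr_ge0 ?exprn_ge0// ltW.
apply: (@le_trans _ _ (K / u)).
  rewrite /heat_tail expRN ler_pdivrMr ?expR_gt0//.
  have uk0 : 0 <= u * kappa by rewrite mulr_ge0 ?ltW.
  have := expR_ge1Dxn n uk0.
  rewrite [u * kappa](_ : _ = u / 2 * d ^+ 2); last by rewrite /kappa; field.
  move=> uexp.
  apply: (@le_trans _ _ (K / u * ((u * kappa) ^+ n.+1 / (n.+1)`!%:R))).
    rewrite /K (exprMn _ u) [u ^+ n.+1]exprS.
    have : kappa ^+ n.+1 != 0 by rewrite expf_neq0// gt_eqF.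
    have : ((n.+1)`!%:R : R) != 0 by rewrite pnatr_eq0 -lt0n fact_gt0.
    move: (kappa ^+ _) (_`!%:R) (2 ^+ n) (u ^+ n) => a b c p b0 a0.
    by rewrite le_eqVlt; apply/orP; left; apply/eqP; field; rewrite a0 b0 gt_eqF.
  rewrite ler_wpM2l//; first by rewrite divr_ge0 ?(ltW u0).
  rewrite [u * kappa](_ : _ = u / 2 * d ^+ 2); last by rewrite /kappa; field.
  by apply: le_trans uexp; rewrite lerDr.
have Keu : K / e <= u by near: u; apply: nbhs_pinfty_ge; rewrite num_real.
by rewrite ler_pdivrMr// mulrC -ler_pdivrMr.
Unshelve. all: end_near. Qed.

Variable Phi : E -> R.
Hypothesis Phi_int : lambda.-integrable setT (EFin \o Phi).

Let mPhi : measurable_fun setT Phi.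
Proof. by apply/measurable_EFinP; have /integrableP[] := Phi_int. Qed.

Let norm_int : lambda.-integrable setT (EFin \o (fun y => `|Phi y|)).
Proof. exact: integrable_abse Phi_int. Qed.

Lemma integrable_mul_heat (u : R) (x : E) : 0 < u ->
  lambda.-integrable setT (EFin \o (fun y => Phi y * heat u (y - x))).
Proof.
move=> u0; pose c := Num.sqrt (u / pi) ^+ n.
have := integrableZl measurableT c norm_int.
apply: le_integrable => //.
  by apply/measurable_EFinP/measurable_funM => //; exact: measurable_heat.
move=> y _; rewrite /= lee_fin !normrM normr_id mulrC ler_wpM2r//.
by rewrite !ger0_norm ?heat_ge0 ?exprn_ge0// heat_le// ltW.
Qed.

(** Near [x] the oscillation of [Phi] is small and the heat kernel has mass 1.
    Far from [x], the function [Phi] may be unbounded, but it is integrable and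
    the heat kernel is uniformly small there. *)
Lemma heat_approximation (x : E) : {for x, continuous Phi} ->
  (\int[lambda]_y (Phi y * heat u (y - x))) @[u --> +oo] --> Phi x.
Proof.
move=> Phix; pose L := \int[lambda]_y `|Phi y|.
have L0 : 0 <= L by apply: Rintegral_ge0.
apply/cvgrPdist_le => e e0.
have e20 : 0 < e / 2 by rewrite divr_gt0.
have [d /= d0 Phid] : exists2 d : R, 0 < d & forall y, `|y - x| <= d -> `|Phi y - Phi x| <= e / 2.
  have /cvgrPdist_le/(_ _ e20) := Phix.
  move=> /nbhs_ballP[d /= d0 Bd]; exists (d / 2); first by rewrite divr_gt0.
  move=> y yx; rewrite distrC; apply: Bd; rewrite -ball_normE /ball_/= distrC.
  by rewrite (le_lt_trans yx)// ltr_pdivrMr// ltr_pMr// ltr1n.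
have tail0 : (heat_tail d u * (L + `|Phi x|)) @[u --> +oo] --> (0 : R).
  by rewrite -(mul0r (L + `|Phi x|)); apply: cvgM; [exact: heat_tail_cvg0|exact: cvg_cst].
near=> u.
have u1 : 1 <= u by near: u; exact: nbhs_pinfty_ge.
have u0 : 0 < u by rewrite (lt_le_trans ltr01).
have u20 : 0 < u / 2 by rewrite divr_gt0.
have ht0 : 0 <= heat_tail d u.
  by rewrite !mulr_ge0 ?expR_ge0 ?exprn_ge0// ltW.
have ih := integrable_heat x u0; have ih2 := integrable_heat x u20.
have iPh := integrable_mul_heat x u0.
have iPxh : lambda.-integrable setT (EFin \o (fun y : E => Phi x * heat u (y - x))).
  exact: (integrableZl measurableT (Phi x) ih).
have PhixE : Phi x = \int[lambda]_y (Phi x * heat u (y - x)).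
  by rewrite RintegralZl// Rintegral_heat// mulr1.
have idiff : lambda.-integrable setT
    (EFin \o (fun y => Phi x * heat u (y - x) - Phi y * heat u (y - x))).
  rewrite (_ : EFin \o _ = (fun y => (Phi x * heat u (y - x))%:E - (Phi y * heat u (y - x))%:E)%E) //.
  exact: integrableB.
(* The first summand dominates the integrand near x, the second one far from x. *)
pose B (y : E) := e / 2 * heat u (y - x) +
  heat_tail d u * (`|Phi y| + `|Phi x| * heat (u / 2) (y - x)).
have i1 : lambda.-integrable setT (EFin \o (fun y : E => e / 2 * heat u (y - x))).
  exact: (integrableZl measurableT (e / 2) ih).
have i3 : lambda.-integrable setT (EFin \o (fun y : E => `|Phi x| * heat (u / 2) (y - x))).
  exact: (integrableZl measurableT `|Phi x| ih2).
have i4 : lambda.-integrable setT (EFin \o (fun y : E => `|Phi y| + `|Phi x| * heat (u / 2) (y - x))).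
  rewrite (_ : EFin \o _ = (fun y => `|Phi y|%:E + (`|Phi x| * heat (u / 2) (y - x))%:E)%E) //.
  exact: integrableD.
have i2 : lambda.-integrable setT (EFin \o (fun y : E =>
    heat_tail d u * (`|Phi y| + `|Phi x| * heat (u / 2) (y - x)))).
  exact: (integrableZl measurableT (heat_tail d u) i4).
have iB : lambda.-integrable setT (EFin \o B).
  rewrite (_ : EFin \o _ = (fun y => (e / 2 * heat u (y - x))%:E + (heat_tail d u *
    (`|Phi y| + `|Phi x| * heat (u / 2) (y - x)))%:E)%E) //.
  exact: integrableD.
rewrite [in leLHS]PhixE -RintegralB//.
apply: (le_trans (le_normr_Rintegral measurableT idiff)).
apply: (@le_trans _ _ (\int[lambda]_y B y)).
  apply: le_Rintegral => //; first exact: integrable_abse idiff.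
  move=> y _; rewrite -mulrBl normrM [`|heat _ _|]ger0_norm ?heat_ge0//.
  rewrite distrC /B.
  have [yx|yx] := leP `|y - x| d.
    rewrite -[leLHS]addr0; apply: lerD.
      by rewrite ler_wpM2r ?heat_ge0// Phid.
    by rewrite mulr_ge0// addr_ge0// mulr_ge0// heat_ge0.
  have [far1 far2] := heat_far u1 (ltW d0) yx.
  apply: (@le_trans _ _ ((`|Phi y| + `|Phi x|) * heat u (y - x))).
    by rewrite ler_wpM2r ?heat_ge0// ler_normB.
  rewrite -[leLHS]add0r; apply: lerD.
    by rewrite mulr_ge0 ?heat_ge0// ltW.
  rewrite mulrDl mulrDr lerD//; first by rewrite mulrC ler_wpM2r.
  by rewrite mulrCA ler_wpM2l.
rewrite /B RintegralD// !RintegralZl// RintegralD// RintegralZl// !Rintegral_heat// !mulr1.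
rewrite -/L -lerBrDl [leRHS](_ : _ = e / 2); last by field.
near: u; have /cvgrPdist_le/(_ _ e20) := tail0.
apply: filterS => u; apply: le_trans; rewrite sub0r normrN; exact: ler_norm.
Unshelve. all: end_near. Qed.

End approximate_identity.

(** * Fourier inversion as a bound on quadratic forms *)

Lemma cvg_fin_sum (R : realType) (T : Type) (F : set_system T) {FF : Filter F}
    (J : finType) (f : J -> T -> R) (l : J -> R) :
  (forall j, f j x @[x --> F] --> l j) ->
  (\sum_j f j x) @[x --> F] --> \sum_j l j.
Proof.
move=> fl; rewrite unlock; elim: (index_enum J) => [|j r IH] /=; first exact: cvg_cst.
exact: cvgD.
Qed.

Section fourier_inversion.
Context (R : realType) (n : nat).
Local Notation lambda := (lebesgue_rV R n).
Local Notation E := 'rV[R]_n.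
Variable Phi : E -> R.
Hypothesis Phi_int : lambda.-integrable setT (EFin \o Phi).

Let mPhi : measurable_fun setT Phi.
Proof. by apply/measurable_EFinP; have /integrableP[] := Phi_int. Qed.

Let mcos : measurable_fun setT (@cos R).
Proof. by apply: continuous_measurable_fun; exact: continuous_cos. Qed.

Let msin : measurable_fun setT (@sin R).
Proof. by apply: continuous_measurable_fun; exact: continuous_sin. Qed.

Lemma integrable_cos_transform (w : E) :
  lambda.-integrable setT (EFin \o (fun y => Phi y * cos (dotp y w))).
Proof.
apply: (le_integrable measurableT _ _ Phi_int).
  apply/measurable_EFinP/measurable_funM => //.
  by apply: (measurableT_comp mcos); exact: measurable_dotp.
by move=> y _; rewrite /= lee_fin normrM ler_piMr// cos_max.
Qed.

Lemma integrable_sin_transform (w : E) :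
  lambda.-integrable setT (EFin \o (fun y => Phi y * sin (dotp y w))).
Proof.
apply: (le_integrable measurableT _ _ Phi_int).
  apply/measurable_EFinP/measurable_funM => //.
  by apply: (measurableT_comp msin); exact: measurable_dotp.
by move=> y _; rewrite /= lee_fin normrM ler_piMr// sin_max.
Qed.

Definition cos_transform (w : E) : R := \int[lambda]_y (Phi y * cos (dotp y w)).
Definition sin_transform (w : E) : R := \int[lambda]_y (Phi y * sin (dotp y w)).

(** When the sine transform vanishes, translating [Phi] only multiplies its
    cosine transform by a cosine. *)
Lemma cos_transform_shift (x w : E) : sin_transform w = 0 ->
  \int[lambda]_y (Phi y * cos (dotp (y - x) w)) = cos (dotp x w) * cos_transform w.
Proof.
move=> S0.
have ic := integrable_cos_transform w; have is_ := integrable_sin_transform w.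
transitivity (\int[lambda]_y (cos (dotp x w) * (Phi y * cos (dotp y w)) +
                              sin (dotp x w) * (Phi y * sin (dotp y w)))).
  by apply: eq_Rintegral => y _; rewrite dotpBl cosB; ring.
rewrite RintegralD//; last 2 first.
- exact: (integrableZl measurableT (cos (dotp x w)) ic).
- exact: (integrableZl measurableT (sin (dotp x w)) is_).
by rewrite !RintegralZl// -/(cos_transform w) -/(sin_transform w) S0 mulr0 addr0.
Qed.

(** Integrating this over the second variable gives a heat kernel, and over the
    first one a Fourier transform. *)
Let kernel2 (a : R) (x : E) (p : E * E) : R :=
  Phi p.1 * (gaussian_rV a p.2 * cos (dotp (p.1 - x) p.2)).

Let measurable_kernel2 a x : measurable_fun setT (kernel2 a x).
Proof.
apply: measurable_funM; first exact: measurableT_comp.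
apply: measurable_funM.
  by apply: (measurableT_comp (@measurable_gaussian_rV R n a)); exact: measurable_snd.
apply: (measurableT_comp mcos).
rewrite [X in measurable_fun _ X](_ : _ = (fun p : E * E => \sum_i (p.1 0 i - x 0 i) * p.2 0 i)).
  apply: measurable_sum => i; apply: measurable_funM.
    apply: measurable_funB => //.
    by apply: (measurableT_comp (@measurable_coord R n i)); exact: measurable_fst.
  by apply: (measurableT_comp (@measurable_coord R n i)); exact: measurable_snd.
by apply/funext => p; apply: eq_bigr => i _; rewrite !mxE.
Qed.

Let integrable_kernel2 a x : 0 < a ->
  (lambda \x lambda)%E.-integrable setT (EFin \o kernel2 a x).
Proof.
move=> a0; apply/integrable12ltyP.
  by apply/measurable_EFinP; exact: measurable_kernel2.
pose c := \int[lambda]_w gaussian_rV a w.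
have ig := integrable_gaussian_rV n a0.
apply: (@le_lt_trans _ _ (\int[lambda]_y (`|Phi y| * c)%:E)%E); last first.
  have := integrableZl measurableT c (integrable_abse Phi_int).
  move=> /integrableP[_]; apply: le_lt_trans.
  apply: ge0_le_integral => //.
  - move=> y _; rewrite lee_fin mulr_ge0//.
    by apply: Rintegral_ge0 => w _; exact: gaussian_rV_ge0.
  - by apply/measurable_EFinP/measurable_funM => //; exact: measurableT_comp.
  - apply: measurableT_comp => //; apply/measurable_EFinP/measurable_funM => //.
    exact: measurableT_comp.
  - by move=> y _; rewrite /= lee_fin mulrC ler_norm.
apply: ge0_le_integral => //.
- by move=> y _; apply: integral_ge0.
- apply: (measurable_fun_fubini_tonelli_F (fun p => `|(EFin \o kernel2 a x) p|%E)) => //.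
  by apply: measurableT_comp => //; apply/measurable_EFinP; exact: measurable_kernel2.
- by apply/measurable_EFinP/measurable_funM => //; exact: measurableT_comp.
move=> y _; rewrite EFinM -(EFin_Rintegral ig) -ge0_integralZl//; last 2 first.
- by apply/measurable_EFinP; exact: measurable_gaussian_rV.
- by move=> w _; rewrite lee_fin gaussian_rV_ge0.
apply: ge0_le_integral => //.
- apply: measurableT_comp => //; apply/measurable_EFinP.
  exact: (measurableT_comp (measurable_kernel2 a x) (measurable_pair1 y)).
- by apply/measurable_EFinP/measurable_funM => //; exact: measurable_gaussian_rV.
move=> w _; rewrite lee_fin /kernel2/= normrM ler_wpM2l// normrM.
rewrite ger0_norm ?gaussian_rV_ge0// ler_piMr ?gaussian_rV_ge0//; exact: cos_max.
Qed.

Let integrable_cos_shift (x w : E) :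
  lambda.-integrable setT (EFin \o (fun y => Phi y * cos (dotp (y - x) w))).
Proof.
apply: (le_integrable measurableT _ _ Phi_int).
  apply/measurable_EFinP/measurable_funM => //; apply: (measurableT_comp mcos).
  rewrite [X in measurable_fun _ X](_ : _ = (fun y => dotp y w - dotp x w)).
    by apply: measurable_funB => //; exact: measurable_dotp.
  by apply/funext => y; rewrite dotpBl.
by move=> y _; rewrite /= lee_fin normrM ler_piMr// cos_max.
Qed.

Let kernel2_integral_y a (x w : E) : sin_transform w = 0 ->
  (\int[lambda]_y (kernel2 a x (y, w))%:E =
   (gaussian_rV a w * (cos (dotp x w) * cos_transform w))%:E)%E.
Proof.
move=> S0; rewrite -cos_transform_shift// -RintegralZl//.
rewrite -EFin_Rintegral; last first.
  exact: (integrableZl measurableT (gaussian_rV a w) (integrable_cos_shift x w)).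
by apply: eq_integral => y _; rewrite /kernel2/= mulrCA.
Qed.

Let kernel2_integral_w (u : R) (x y : E) : 0 < u ->
  (\int[lambda]_w (kernel2 (4 * u)^-1 x (y, w))%:E =
   ((2 * pi) ^+ n * (Phi y * heat u (y - x)))%:E)%E.
Proof.
move=> u0; have a0 : 0 < (4 * u)^-1 by rewrite invr_gt0 mulr_gt0.
have ig := integrable_gaussian_rV_cos 0 (y - x) a0.
rewrite (_ : _ * (Phi y * _) = Phi y * \int[lambda]_w
    (gaussian_rV (4 * u)^-1 w * cos (dotp w (y - x) + 0))).
  rewrite -RintegralZl// -EFin_Rintegral; last first.
    exact: (integrableZl measurableT (Phi y) ig).
  by apply: eq_integral => w _; rewrite /kernel2/= addr0 dotpC.
rewrite Rintegral_gaussian_rV_cos// cos0 mul1r mulrCA; congr (_ * _).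
rewrite -[X in _ ^+ X * _](card_ord n) -prodr_const -big_split/=.
apply: eq_bigr => i _; rewrite mulrA; congr (_ * gaussian _ _); last first.
  by field; rewrite gt_eqF.
have p0 := pi_ge0 R; have u1 := ltW u0.
rewrite -[2 * pi]ger0_norm ?mulr_ge0// -sqrtr_sqr -sqrtrM ?sqr_ge0//.
congr Num.sqrt; rewrite invrK exprMn.
by rewrite [in LHS]expr2 [pi ^+ 2]expr2; have := lt0r_neq0 (pi_gt0 R); move: pi => p pn0; field.
Qed.

Lemma integrable_inversion (a : R) (x : E) : 0 < a -> (forall w, sin_transform w = 0) ->
  lambda.-integrable setT
    (EFin \o (fun w => gaussian_rV a w * (cos (dotp x w) * cos_transform w))).
Proof.
move=> a0 S0; pose L := \int[lambda]_y `|Phi y|.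
have iLg := integrableZl measurableT L (integrable_gaussian_rV n a0).
apply: (le_integrable measurableT _ _ iLg).
  have := measurable_fubini_G (integrable_kernel2 x a0).
  congr (measurable_fun _ _); apply/funext => w.
  by rewrite /fubini_G /= -kernel2_integral_y.
move=> w _; rewrite /= lee_fin normrM ger0_norm ?gaussian_rV_ge0// mulrC.
rewrite [leRHS]ger0_norm; last by rewrite mulr_ge0 ?gaussian_rV_ge0// Rintegral_ge0.
rewrite ler_wpM2r ?gaussian_rV_ge0// -cos_transform_shift//.
apply: (le_trans (le_normr_Rintegral measurableT (integrable_cos_shift x w))).
apply: le_Rintegral => //.
- exact: integrable_abse (integrable_cos_shift x w).
- exact: integrable_abse Phi_int.
- by move=> y _; rewrite normrM ler_piMr// cos_max.
Qed.

(** The Gaussian in the frequency variable makes the double integral converge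
    absolutely, so Fubini's theorem applies. *)
Lemma gaussian_inversion (u : R) (x : E) : 0 < u -> (forall w, sin_transform w = 0) ->
  (2 * pi) ^+ n * \int[lambda]_y (Phi y * heat u (y - x)) =
  \int[lambda]_w (gaussian_rV (4 * u)^-1 w * (cos (dotp x w) * cos_transform w)).
Proof.
move=> u0 S0; have a0 : 0 < (4 * u)^-1 by rewrite invr_gt0 mulr_gt0.
rewrite -RintegralZl//; last exact: integrable_mul_heat.
apply: EFin_inj; rewrite -!EFin_Rintegral; last 2 first.
- exact: integrable_inversion.
- exact: (integrableZl measurableT ((2 * pi) ^+ n) (integrable_mul_heat Phi_int x u0)).
transitivity (\int[lambda]_y \int[lambda]_w (kernel2 (4 * u)^-1 x (y, w))%:E)%E.
  by apply: eq_integral => y _; rewrite kernel2_integral_w.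
rewrite (Fubini (integrable_kernel2 x a0)).
by apply: eq_integral => w _; exact: kernel2_integral_y.
Qed.

(** After smoothing [Phi] by the heat kernel, the quadratic form becomes the
    integral of [|sum_i a_i exp (i <x_i, w>)|^2] against the cosine transform
    times a Gaussian that is at most 1. It is dominated by
    [c D^2 (1 + |w|^2)^(2 - alpha)], whose integral is finite and does not depend
    on the smoothing parameter [u]. *)
Lemma positive_definite_bound (alpha c : R) : (0 < n)%N -> n%:R / 2 + 2 < alpha ->
  continuous Phi -> (forall w, sin_transform w = 0) ->
  (forall w, 0 <= cos_transform w <= c * (1 + enorm w ^+ 2) `^ (- alpha)) ->
  exists2 M : R, 0 <= M & forall (I : finType) (a : I -> R) (x : I -> E) (D : R),
    (forall w, (\sum_i a i * cos (dotp (x i) w)) ^+ 2 +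
               (\sum_i a i * sin (dotp (x i) w)) ^+ 2 <= D ^+ 2 * (1 + enorm w ^+ 2) ^+ 2) ->
    \sum_i \sum_j a i * a j * Phi (x i - x j) <= M * D ^+ 2.
Proof.
move=> n0 alphan cPhi S0 Cw.
have nR0 : 0 < n%:R :> R by rewrite ltr0n.
pose s := (alpha - 2) / n%:R.
have s2 : 2^-1 < s by rewrite ltr_pdivlMr// ltrBrDr mulrC.
have alpha2 : 0 <= alpha - 2.
  by rewrite subr_ge0; apply/ltW/(le_lt_trans _ alphan); rewrite lerDr divr_ge0.
have c0 : 0 <= c.
  have /andP[C0 C1] := Cw 0.
  have p0 : 0 < (1 + enorm (0 : E) ^+ 2) `^ (- alpha).
    by rewrite powR_gt0// one_plus_sqr_gt0.
  by have := le_trans C0 C1; rewrite pmulr_lge0.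
have iW := integrable_decay_rV n s2.
pose W := \int[lambda]_w \prod_i decay s ((w : E) 0 i).
have W0 : 0 <= W.
  by apply: Rintegral_ge0 => w _; apply: prodr_ge0 => i _; exact: decay_ge0.
have pn : 0 < (2 * pi : R) ^+ n by rewrite exprn_gt0// mulr_gt0// pi_gt0.
exists (((2 * pi) ^+ n)^-1 * (c * W)); first by rewrite mulr_ge0 ?invr_ge0 ?(ltW pn)// mulr_ge0.
move=> I a x D aD.
pose T u := \sum_i \sum_j a i * a j * \int[lambda]_y (Phi y * heat u (y - (x i - x j))).
have TPhi : T u @[u --> +oo] --> \sum_i \sum_j a i * a j * Phi (x i - x j).
  apply: cvg_fin_sum => i; apply: cvg_fin_sum => j.
  by apply: cvgM; [exact: cvg_cst|apply: heat_approximation => //; exact: cPhi].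
apply: (cvgr_to_le TPhi); near=> u.
have u0 : 0 < u by near: u; exact: nbhs_pinfty_gt.
have a0 : 0 < (4 * u)^-1 by rewrite invr_gt0 mulr_gt0.
rewrite -mulrA mulrC ler_pdivlMr// mulrC /T.
(* The squared modulus of sum_i a_i exp (i <x_i, w>), expanded by the formula
   for the cosine of a difference. *)
pose Q (w : E) := (\sum_i a i * cos (dotp (x i) w)) ^+ 2 + (\sum_i a i * sin (dotp (x i) w)) ^+ 2.
have QE (w : E) : Q w = \sum_i \sum_j a i * a j * cos (dotp (x i - x j) w).
  rewrite /Q !expr2 !big_distrl -big_split/=; apply: eq_bigr => i _.
  rewrite !big_distrr -big_split/=; apply: eq_bigr => j _.
  by rewrite dotpBl cosB; ring.
have iT i j := integrable_inversion (x i - x j) a0 S0.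
have itZ i j : lambda.-integrable setT (EFin \o (fun w => a i * a j *
    (gaussian_rV (4 * u)^-1 w * (cos (dotp (x i - x j) w) * cos_transform w)))).
  exact: (integrableZl measurableT (a i * a j) (iT i j)).
have sumI (J : finType) (g : J -> E -> R) :
    (forall j, lambda.-integrable setT (EFin \o g j)) ->
    lambda.-integrable setT (EFin \o (fun w => \sum_j g j w)) /\
    \int[lambda]_w (\sum_j g j w) = \sum_j \int[lambda]_w g j w.
  move=> ig; elim: (index_enum J) => [|j r [ir Er]].
    rewrite (_ : (fun w => \sum_(j <- [::]) g j w) = cst 0); last first.
      by apply/funext => w; rewrite big_nil.
    by rewrite big_nil; split; [exact: integrable0|rewrite /Rintegral integral0].
  rewrite (_ : (fun w => \sum_(i <- j :: r) g i w) =
      (fun w => g j w + \sum_(i <- r) g i w)); last first.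
    by apply/funext => w; rewrite big_cons.
  rewrite big_cons RintegralD// Er; split => //.
  exact: (integrableD measurableT (ig j) ir).
have [iQ EQ] := sumI _ _ (fun i => (sumI _ _ (itZ i)).1).
have sumE : (fun w : E => gaussian_rV (4 * u)^-1 w * (Q w * cos_transform w)) =
    (fun w => \sum_i \sum_j a i * a j *
      (gaussian_rV (4 * u)^-1 w * (cos (dotp (x i - x j) w) * cos_transform w))).
  apply/funext => w; rewrite QE [in LHS]big_distrl big_distrr/=.
  apply: eq_bigr => i _; rewrite [in LHS]big_distrl big_distrr/=.
  by apply: eq_bigr => j _; ring.
have -> : (2 * pi) ^+ n * T u =
    \int[lambda]_w (gaussian_rV (4 * u)^-1 w * (Q w * cos_transform w)).
  rewrite sumE EQ big_distrr/=; apply: eq_bigr => i _.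
  rewrite (sumI _ _ (itZ i)).2 big_distrr/=; apply: eq_bigr => j _.
  by rewrite RintegralZl// -gaussian_inversion// mulrCA.
rewrite mulrAC -RintegralZl//.
apply: le_Rintegral => //.
- by rewrite sumE.
- exact: (integrableZl measurableT (c * D ^+ 2) iW).
move=> w _.
have /andP[C0 C1] := Cw w.
have Q0 : 0 <= Q w by rewrite addr_ge0 ?sqr_ge0.
apply: (@le_trans _ _ (Q w * cos_transform w)).
  by rewrite ler_piMl ?mulr_ge0// gaussian_rV_le1// ltW.
apply: (@le_trans _ _ (D ^+ 2 * (1 + enorm w ^+ 2) ^+ 2 * (c * (1 + enorm w ^+ 2) `^ (- alpha)))).
  by apply: ler_pM => //; exact: aD.
have w0 : 0 < 1 + enorm w ^+ 2 by exact: one_plus_sqr_gt0.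
rewrite [leLHS](_ : _ = c * D ^+ 2 * (1 + enorm w ^+ 2) `^ (- (alpha - 2))).
  by apply: ler_wpM2l; [rewrite mulr_ge0 ?sqr_ge0|exact: weight_le_decay].
rewrite opprB powRD ?(gt_eqF w0) ?implybT//.
  rewrite powR_mulrn ?(ltW w0)//; ring.
Unshelve. all: end_near. Qed.

End fourier_inversion.

(** * Difference quotients of complex exponentials *)

Section trigonometric_bounds.
Context (R : realType).
Implicit Types u t s w : R.

Lemma sin_norm_le u : `|sin u| <= `|u|.
Proof.
wlog u0 : u / 0 <= u => [hw|].
  have [|u0] := leP 0 u; first exact: hw.
  by have := hw (- u); rewrite sinN !normrN; apply; rewrite oppr_ge0 ltW.
have [c _] := @MVT_segment R sin cos 0 u u0 (fun x _ => is_derive_sin x)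
  (continuous_subspaceT (@continuous_sin R)).
by rewrite sin0 !subr0 => ->; rewrite normrM ler_piMl// cos_max.
Qed.

Lemma one_sub_cosE u : 1 - cos u = 2 * sin (u / 2) ^+ 2.
Proof.
rewrite {1}(_ : u = u / 2 + u / 2); last by field.
by rewrite cosD -!expr2; have := cos2Dsin2 (u / 2); lra.
Qed.

Lemma one_sub_cos_ge0 u : 0 <= 1 - cos u.
Proof. by rewrite one_sub_cosE mulr_ge0 ?sqr_ge0. Qed.

Lemma one_sub_cos_le_sqr u : 1 - cos u <= u ^+ 2 / 2.
Proof.
rewrite one_sub_cosE; have := sin_norm_le (u / 2).
rewrite -(@ler_pXn2r _ 2)// ?nnegrE// !real_normK ?num_real// expr_div_n.
by lra.
Qed.

Lemma one_sub_cos_le_norm u : 1 - cos u <= `|u|.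
Proof.
rewrite one_sub_cosE; have := sin_norm_le (u / 2).
have : `|sin (u / 2)| <= 1 by exact: sin_max.
have -> : `|u / 2| = `|u| / 2 by rewrite normrM (@ger0_norm _ 2^-1).
rewrite -(real_normK (num_real (sin (u / 2)))).
by have := normr_ge0 (sin (u / 2)); move: `|sin _| `|u| => a b; nra.
Qed.

Lemma sin_sub_le u : `|sin u - u| <= u ^+ 2.
Proof.
wlog u0 : u / 0 <= u => [hw|].
  have [|u0] := leP 0 u; first exact: hw.
  have := hw (- u); rewrite sinN sqrrN -opprB opprK addrC normrN distrC; apply.
  by rewrite oppr_ge0 ltW.
have [c] := @MVT_segment R sin cos 0 u u0 (fun x _ => is_derive_sin x)
  (continuous_subspaceT (@continuous_sin R)).
rewrite in_itv/= => /andP[c0 cu].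
rewrite sin0 !subr0 => ->; rewrite -{2}[u]mul1r -mulrBl normrM (ger0_norm u0).
rewrite expr2 ler_wpM2r// distrC ger0_norm ?one_sub_cos_ge0//.
by rewrite (le_trans (one_sub_cos_le_norm c))// ger0_norm.
Qed.

(** [quotient_re t w] and [quotient_im t w] are the real and imaginary parts of
    [(exp (i t w) - 1) / t]. *)
Definition quotient_re t w := (cos (t * w) - 1) / t.
Definition quotient_im t w := sin (t * w) / t.

Lemma quotient_re_le t w : t != 0 -> `|quotient_re t w| <= `|t| * w ^+ 2.
Proof.
move=> t0; rewrite /quotient_re normrM normfV distrC (ger0_norm (one_sub_cos_ge0 _)).
rewrite ler_pdivrMr ?normr_gt0//; apply: (le_trans (one_sub_cos_le_sqr _)).
rewrite [leRHS]mulrAC -expr2 real_normK ?num_real// exprMn.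
have := mulr_ge0 (sqr_ge0 t) (sqr_ge0 w); lra.
Qed.

Lemma quotient_im_le t w : t != 0 -> `|quotient_im t w - w| <= `|t| * w ^+ 2.
Proof.
move=> t0; rewrite /quotient_im (_ : _ - w = (sin (t * w) - t * w) / t); last by field.
rewrite normrM normfV ler_pdivrMr ?normr_gt0//; apply: (le_trans (sin_sub_le _)).
by rewrite [leRHS]mulrAC -expr2 real_normK ?num_real// exprMn.
Qed.

(** The common factor [exp (i th)] has modulus 1, and both difference quotients
    of [exp (i t w)] are close to the derivative [i w] at 0. *)
Lemma quotient_diff_bound t s w th : t != 0 -> s != 0 ->
  ((cos (th + t * w) - cos th) / t - (cos (th + s * w) - cos th) / s) ^+ 2 +
  ((sin (th + t * w) - sin th) / t - (sin (th + s * w) - sin th) / s) ^+ 2 <=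
  (2 * (`|t| + `|s|)) ^+ 2 * (w ^+ 2) ^+ 2.
Proof.
move=> t0 s0.
rewrite [leLHS](_ : _ = (quotient_re t w - quotient_re s w) ^+ 2 + (quotient_im t w - quotient_im s w) ^+ 2); last first.
  transitivity ((cos th ^+ 2 + sin th ^+ 2) *
    ((quotient_re t w - quotient_re s w) ^+ 2 + (quotient_im t w - quotient_im s w) ^+ 2)).
    by rewrite !cosD !sinD /quotient_re /quotient_im; field; rewrite t0 s0.
  by rewrite cos2Dsin2 mul1r.
have h1 : `|quotient_re t w - quotient_re s w| <= (`|t| + `|s|) * w ^+ 2.
  by rewrite (le_trans (ler_normB _ _))// mulrDl lerD// quotient_re_le.
have h2 : `|quotient_im t w - quotient_im s w| <= (`|t| + `|s|) * w ^+ 2.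
  rewrite (_ : _ - _ = (quotient_im t w - w) - (quotient_im s w - w)); last by ring.
  by rewrite (le_trans (ler_normB _ _))// mulrDl lerD// quotient_im_le.
rewrite -(real_normK (num_real (quotient_re t w - _))) -(real_normK (num_real (quotient_im t w - _))).
have := normr_ge0 (quotient_re t w - quotient_re s w); have := normr_ge0 (quotient_im t w - quotient_im s w).
move: h1 h2; rewrite exprMn -mulrA -exprMn.
by move: `|quotient_re _ _ - _| `|quotient_im _ _ - _| (_ * _) => a b c; nra.
Qed.

(** The expression is the squared modulus of
    [(exp (i th) - exp (i ph)) (exp (i t w) - 1) / t]; each of the two factors is
    bounded by the length of the corresponding arc. *)
Lemma quotient_shift_bound t w th ph : t != 0 ->
  ((cos (th + t * w) - cos th) / t - (cos (ph + t * w) - cos ph) / t) ^+ 2 +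
  ((sin (th + t * w) - sin th) / t - (sin (ph + t * w) - sin ph) / t) ^+ 2 <=
  (th - ph) ^+ 2 * w ^+ 2.
Proof.
move=> t0.
rewrite [leLHS](_ : _ = (2 * (1 - cos (th - ph))) * (2 * (1 - cos (t * w)) / t ^+ 2)); last first.
  transitivity (((cos th - cos ph) ^+ 2 + (sin th - sin ph) ^+ 2) *
    (((cos (t * w) - 1) ^+ 2 + sin (t * w) ^+ 2) / t ^+ 2)).
    by rewrite !cosD !sinD; field.
  have e1 a b : (cos a - cos b) ^+ 2 + (sin a - sin b) ^+ 2 = 2 * (1 - cos (a - b)) :> R.
    transitivity ((cos a ^+ 2 + sin a ^+ 2) + (cos b ^+ 2 + sin b ^+ 2)
      - 2 * (cos a * cos b + sin a * sin b)); first by ring.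
    by rewrite !cos2Dsin2 cosB; ring.
  rewrite e1; congr (_ * (_ / _)).
  by have := e1 (t * w) 0; rewrite cos0 sin0 !subr0.
apply: ler_pM.
- by rewrite mulr_ge0// one_sub_cos_ge0.
- by rewrite divr_ge0 ?sqr_ge0// mulr_ge0// one_sub_cos_ge0.
- by have := one_sub_cos_le_sqr (th - ph); lra.
- rewrite ler_pdivrMr ?exprn_even_gt0// mulrC -exprMn.
  by have := one_sub_cos_le_sqr (t * w); lra.
Qed.

End trigonometric_bounds.

(** * Difference quotients of the reproducing kernel *)

Section kernel_function.
Context (R : realType) (d : nat).
Local Notation E := 'rV[R]_d.

(** The order on complex numbers relates only numbers with the same imaginary
    part, so the two-sided bound on the Fourier transform also says that the sine
    transform of [Phi] vanishes. *)
Lemma kernel_function_bound (alpha : R) (Phi : E -> R) :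
  (0 < d)%N -> d%:R / 2 + 2 < alpha -> sobolev_kernel_function alpha Phi ->
  exists2 K : R, 0 <= K & forall (I : finType) (a : I -> R) (x : I -> E) (D : R),
    (forall w, (\sum_i a i * cos (dotp (x i) w)) ^+ 2 +
               (\sum_i a i * sin (dotp (x i) w)) ^+ 2 <= D ^+ 2 * (1 + enorm w ^+ 2) ^+ 2) ->
    \sum_i \sum_j a i * a j * Phi (x i - x j) <= K * D ^+ 2.
Proof.
move=> d0 alphad [Phi_int cPhi [c1 [c2 [c10 c20 PhiF]]]].
pose c : R := (2 * pi) `^ (- (d%:R / 2)).
have c0 : 0 < c by rewrite powR_gt0// mulr_gt0// pi_gt0.
have FE w : 0 <= cos_transform Phi w <= c2 / c * (1 + enorm w ^+ 2) `^ (- alpha) /\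
    sin_transform Phi w = 0.
  have /andP[] := PhiF w.
  rewrite /fourier -/c -/(cos_transform Phi w) -/(sin_transform Phi w).
  rewrite !complex.lecE /= => /andP[/eqP S0 C0] /andP[_ C1]; split.
    rewrite -[X in X <= _ <= _](mulr0 0).
    have -> : cos_transform Phi w = c^-1 * (c * cos_transform Phi w).
      by rewrite mulrA mulVf ?gt_eqF// mul1r.
    rewrite mul0r mulr_ge0/=; last 2 first.
    - by rewrite invr_ge0 ltW.
    - by apply: le_trans C0; rewrite mulr_ge0 ?powR_ge0// ltW.
    by rewrite [_ / c]mulrC -mulrA ler_wpM2l// invr_ge0 ltW.
  by move/eqP : S0; rewrite oppr_eq0 mulf_eq0 gt_eqF//= => /eqP.
apply: (@positive_definite_bound R d Phi Phi_int alpha (c2 / c)) => //.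
- by move=> w; case: (FE w).
- by move=> w; case: (FE w).
Qed.

End kernel_function.

Section difference_quotients.
Context (R : realType) (d : nat) (Omega : set 'rV[R]_d) (alpha : R)
  (Phi : 'rV[R]_d -> R) (H : completeNormedModType R) (ip : H -> H -> R)
  (ev : H -> 'rV[R]_d -> R).
Local Notation E := 'rV[R]_d.
Hypothesis d_gt0 : (0 < d)%N.
Hypothesis alpha_gt : d%:R / 2 + 2 < alpha.
Hypothesis Phi_kernel : sobolev_kernel_function alpha Phi.
Hypothesis H_rkhs : sobolev_rkhs Omega alpha Phi ip ev.

Let ipC := rkhs_ipC H_rkhs.
Let ip_lin := rkhs_ip_linear H_rkhs.
Let ip_norm := rkhs_ip_norm H_rkhs.

Lemma reproducing_kernel : exists k : E -> H, forall y, Omega y ->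
  (forall x, Omega x -> ev (k y) x = Phi (x - y)) /\
  (forall v, ip v (k y) = ev v y).
Proof.
suff /choice[k kP] : forall y, exists ky : H, Omega y ->
    (forall x, Omega x -> ev ky x = Phi (x - y)) /\ (forall v, ip v ky = ev v y).
  by exists k.
move=> y; have [Oy|nOy] := pselect (Omega y); last by exists 0.
by have [ky kyP] := rkhs_kernel H_rkhs Oy; exists ky.
Qed.

Variable k : E -> H.
Hypothesis kP : forall y, Omega y ->
  (forall x, Omega x -> ev (k y) x = Phi (x - y)) /\
  (forall v, ip v (k y) = ev v y).

(** The Gram matrix of the kernel functions [k (x i)] has the entries
    [Phi (x i - x j)], by the reproducing property. *)
Lemma norm_kernel_sum (I : finType) (a : I -> R) (x : I -> E) :
  (forall i, Omega (x i)) ->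
  `|\sum_i a i *: k (x i)| ^+ 2 = \sum_i \sum_j a i * a j * Phi (x i - x j).
Proof.
move=> Ox; rewrite ip_norm (ip_suml ip_lin); apply: eq_bigr => i _.
rewrite ipC (ip_suml ip_lin) big_distrr/=; apply: eq_bigr => j _.
by rewrite (kP (Ox i)).2 (kP (Ox j)).1// mulrA.
Qed.

Lemma kernel_sum_bound : exists2 K : R, 0 <= K &
  forall (I : finType) (a : I -> R) (x : I -> E) (D : R),
  (forall i, Omega (x i)) -> 0 <= D ->
  (forall w, (\sum_i a i * cos (dotp (x i) w)) ^+ 2 +
             (\sum_i a i * sin (dotp (x i) w)) ^+ 2 <= D ^+ 2 * (1 + enorm w ^+ 2) ^+ 2) ->
  `|\sum_i a i *: k (x i)| <= K * D.
Proof.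
have [M M0 MP] := kernel_function_bound d_gt0 alpha_gt Phi_kernel.
exists (Num.sqrt M) => // I a x D Ox D0 aD.
rewrite -(@ler_pXn2r _ 2)// ?nnegrE ?mulr_ge0// norm_kernel_sum// exprMn sqr_sqrtr//.
exact: MP.
Qed.

Let dotp_shift (x w : E) t j : dotp (t *: delta_mx 0 j + x) w = dotp x w + t * w 0 j.
Proof.
rewrite dotpDl dotpZl addrC; congr (_ + _ * _).
rewrite /dotp (bigD1 j)//= big1 ?addr0; last first.
  by move=> i ij; rewrite !mxE /= (negbTE ij) mul0r.
by rewrite !mxE !eqxx mul1r.
Qed.

Definition kernel_quotient (j : 'I_d) (x : E) (t : R) : H :=
  t^-1 *: (k (t *: delta_mx 0 j + x) - k x).

(** The difference of two difference quotients is a combination of four values of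
    the kernel. *)
Lemma kernel_sum_bound4 : exists2 K : R, 0 <= K &
  forall (a1 a2 a3 a4 : R) (x1 x2 x3 x4 : E) (D : R),
  [/\ Omega x1, Omega x2, Omega x3 & Omega x4] -> 0 <= D ->
  (forall w,
    (a1 * cos (dotp x1 w) + a2 * cos (dotp x2 w) + a3 * cos (dotp x3 w) + a4 * cos (dotp x4 w)) ^+ 2 +
    (a1 * sin (dotp x1 w) + a2 * sin (dotp x2 w) + a3 * sin (dotp x3 w) + a4 * sin (dotp x4 w)) ^+ 2
    <= D ^+ 2 * (1 + enorm w ^+ 2) ^+ 2) ->
  `|a1 *: k x1 + a2 *: k x2 + a3 *: k x3 + a4 *: k x4| <= K * D.
Proof.
have [K K0 KP] := kernel_sum_bound; exists K => //.
move=> a1 a2 a3 a4 x1 x2 x3 x4 D [Ox1 Ox2 Ox3 Ox4] D0 aD.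
have := KP _ (fun i : 'I_4 => [:: a1; a2; a3; a4]`_i) (fun i : 'I_4 => [:: x1; x2; x3; x4]`_i) D.
rewrite !big_ord_recl big_ord0/= !addr0 !addrA => bound; apply: bound => //.
  by case=> -[|[|[|[|]]]].
move=> w; have := aD w.
by rewrite !big_ord_recl !big_ord0/= !addr0 !addrA.
Qed.

(** The second-order term of the difference quotients costs two powers of the
    frequency, that is one factor [1 + |w|^2]. *)
Let coord_le_weight (w : E) j : (w 0 j ^+ 2) ^+ 2 <= (1 + enorm w ^+ 2) ^+ 2.
Proof.
rewrite ler_pXn2r ?nnegrE ?sqr_ge0//; last by rewrite ltW// one_plus_sqr_gt0.
by rewrite (le_trans (coord_sqr_le_enorm w j))// lerDr.
Qed.

Let dotp_sqr_le (z w : E) : dotp z w ^+ 2 <= (d%:R * `|z|) ^+ 2 * enorm w ^+ 2.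
Proof.
rewrite -exprMn -(real_normK (num_real (dotp z w))).
have w0 : 0 <= enorm w by rewrite sqrtr_ge0.
rewrite ler_pXn2r ?nnegrE ?mulr_ge0//.
rewrite (le_trans (ler_norm_sum _ _ _))//.
rewrite -mulrA.
rewrite [leRHS](_ : _ = \sum_(i < d) `|z| * enorm w); last first.
  by rewrite sumr_const card_ord mulr_natl.
apply: ler_sum => i _; rewrite normrM ler_pM// ?coord_le_norm//.
by rewrite -(@ler_pXn2r _ 2)// ?nnegrE// real_normK ?num_real// coord_sqr_le_enorm.
Qed.

Lemma kernel_quotient_lipschitz : exists2 K : R, 0 <= K &
  (forall j x t s, t != 0 -> s != 0 -> Omega x -> Omega (t *: delta_mx 0 j + x) ->
     Omega (s *: delta_mx 0 j + x) ->
     `|kernel_quotient j x t - kernel_quotient j x s| <= K * (`|t| + `|s|)) /\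
  (forall j x y t, t != 0 -> Omega x -> Omega y -> Omega (t *: delta_mx 0 j + x) ->
     Omega (t *: delta_mx 0 j + y) ->
     `|kernel_quotient j x t - kernel_quotient j y t| <= K * `|x - y|).
Proof.
have [K K0 KP] := kernel_sum_bound4.
exists (K * (2 + d%:R)); first by rewrite mulr_ge0// addr_ge0.
split.
- move=> j x t s t0 s0 Ox Oxt Oxs.
  have -> : kernel_quotient j x t - kernel_quotient j x s =
      t^-1 *: k (t *: delta_mx 0 j + x) + (- t^-1) *: k x + (- s^-1) *: k (s *: delta_mx 0 j + x) + s^-1 *: k x.
    by rewrite /kernel_quotient !scalerBr !scaleNr opprB !addrA -!addrA [X in _ + (_ + X)]addrC.
  apply: (@le_trans _ _ (K * (2 * (`|t| + `|s|)))); last first.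
    by rewrite -mulrA; apply: ler_wpM2l => //; apply: ler_wpM2r; rewrite ?addr_ge0// lerDl.
  apply: KP => // w.
  apply: (@le_trans _ _ ((2 * (`|t| + `|s|)) ^+ 2 * (w 0 j ^+ 2) ^+ 2)); last first.
    by rewrite ler_wpM2l ?sqr_ge0.
  apply: le_trans (quotient_diff_bound (w 0 j) (dotp x w) t0 s0).
  rewrite !dotp_shift le_eqVlt; apply/orP; left; apply/eqP.
  by congr (_ ^+ 2 + _ ^+ 2); ring.
- move=> j x y t t0 Ox Oy Oxt Oyt.
  have -> : kernel_quotient j x t - kernel_quotient j y t =
      t^-1 *: k (t *: delta_mx 0 j + x) + (- t^-1) *: k x + (- t^-1) *: k (t *: delta_mx 0 j + y) + t^-1 *: k y.
    by rewrite /kernel_quotient !scalerBr !scaleNr opprB !addrA -!addrA [X in _ + (_ + X)]addrC.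
  apply: (@le_trans _ _ (K * (d%:R * `|x - y|))); last first.
    by rewrite -mulrA; apply: ler_wpM2l => //; apply: ler_wpM2r; rewrite ?lerDr.
  apply: KP => // w.
  apply: (@le_trans _ _ ((dotp x w - dotp y w) ^+ 2 * w 0 j ^+ 2)).
    apply: le_trans (quotient_shift_bound (w 0 j) (dotp x w) (dotp y w) t0).
    rewrite !dotp_shift le_eqVlt; apply/orP; left; apply/eqP.
    by congr (_ ^+ 2 + _ ^+ 2); ring.
  rewrite -dotpBl.
  have cw := coord_sqr_le_enorm w j; have dw := dotp_sqr_le (x - y) w.
  apply: (@le_trans _ _ ((d%:R * `|x - y|) ^+ 2 * enorm w ^+ 2 * enorm w ^+ 2)).
    by apply: ler_pM; rewrite ?sqr_ge0.
  rewrite -mulrA ler_wpM2l ?sqr_ge0// -expr2 ler_pXn2r ?nnegrE ?sqr_ge0//.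
    by rewrite lerDr.
  by rewrite ltW// one_plus_sqr_gt0.
Qed.

End difference_quotients.

(** * Derivatives as bounded functionals *)

Section derivative_representers.
Context (R : realType) (d : nat) (Omega : set 'rV[R]_d) (alpha : R)
  (Phi : 'rV[R]_d -> R) (H : completeNormedModType R) (ip : H -> H -> R)
  (ev : H -> 'rV[R]_d -> R).
Local Notation E := 'rV[R]_d.
Hypothesis d_gt0 : (0 < d)%N.
Hypothesis alpha_gt : d%:R / 2 + 2 < alpha.
Hypothesis openOmega : open Omega.
Hypothesis Phi_kernel : sobolev_kernel_function alpha Phi.
Hypothesis H_rkhs : sobolev_rkhs Omega alpha Phi ip ev.

Let ipC := rkhs_ipC H_rkhs.
Let ip_lin := rkhs_ip_linear H_rkhs.
Let ip_norm := rkhs_ip_norm H_rkhs.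

Lemma ip_continuous (v : H) : continuous (fun u => ip u v).
Proof.
move=> u; apply/cvgrPdist_lt => e e0.
have v1 : 0 < `|v| + 1 by rewrite ltr_pwDr.
near=> w; rewrite -(ipBl ip_lin).
apply: (le_lt_trans (cauchy_schwarz ipC ip_lin ip_norm _ _)).
apply: (@le_lt_trans _ _ (`|u - w| * (`|v| + 1))); first by rewrite ler_wpM2l// lerDl.
rewrite -ltr_pdivlMr//; near: w.
by apply: cvgr_dist_lt; rewrite ?divr_gt0.
Unshelve. all: end_near. Qed.

Lemma near_shift_in (x v : E) : Omega x ->
  \forall t \near (0 : R)^', t != 0 /\ Omega (t *: v + x).
Proof.
move=> Ox.
have : t *: v + x @[t --> (0 : R)] --> 0 *: v + x.
  by apply: cvgD; [apply: cvgZr_tmp; exact: cvg_id|exact: cvg_cst].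
rewrite scale0r add0r => /(_ Omega) tv.
have tvO : \forall t \near (0 : R), Omega (t *: v + x).
  exact: tv (open_nbhs_nbhs (conj openOmega Ox)).
suff : \forall t \near (0 : R), t != 0 -> t != 0 /\ Omega (t *: v + x) by [].
by apply: filterS tvO => t Ot tn0; split.
Qed.

(** The difference quotients of [k] are Cauchy in [H] as the step tends to 0.
    Pairing their limit with [v] gives the limit of the difference quotients of
    [ev v], and the Lipschitz bound survives the limit. *)
Lemma pderiv_representers : exists (kappa : 'I_d -> E -> H) (K : R), 0 <= K /\
  (forall j x v, Omega x -> pderiv j (ev v) x = ip v (kappa j x)) /\
  (forall j x y, Omega x -> Omega y -> `|kappa j x - kappa j y| <= K * `|x - y|).
Proof.
have [k kP] := reproducing_kernel H_rkhs.
have [K K0 [Kts Kxy]] := kernel_quotient_lipschitz d_gt0 alpha_gt Phi_kernel H_rkhs kP.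
have qcvg j x : Omega x ->
    exists kx : H, kernel_quotient k j x t @[t --> (0 : R)^'] --> kx.
  move=> Ox; apply/cvg_ex/cauchy_cvgP/cauchy_ballP => eta eta0.
  pose delta := eta / (2 * (K + 1)).
  have K1 : 0 < 2 * (K + 1) by rewrite mulr_gt0// ltr_pwDr.
  have delta0 : 0 < delta by rewrite divr_gt0.
  pose Q := [set t : R | (t != 0 /\ Omega (t *: delta_mx 0 j + x)) /\ `|t| < delta].
  have Q0 : \forall t \near (0 : R)^', Q t.
    near=> t; split; first by near: t; exact: near_shift_in.
    by near: t; exact: dnbhs0_lt.
  rewrite near_map2; exists (Q, Q); first by split.
  move=> [t s] /= [[[t0 Ot] td] [[s0 Os] sd]].
  rewrite -ball_normE /ball_/=; apply: (le_lt_trans (Kts _ _ _ _ t0 s0 Ox Ot Os)).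
  have etaE : eta = (K + 1) * (delta + delta).
    by rewrite /delta; field; rewrite gt_eqF// ltr_pwDr.
  rewrite etaE; apply: (@le_lt_trans _ _ (K * (delta + delta))).
    by rewrite ler_wpM2l// lerD// ltW.
  by rewrite ltr_pM2r ?addr_gt0// ltrDl.
have kchoice (jx : 'I_d * E) : exists kx : H, Omega jx.2 ->
    kernel_quotient k jx.1 jx.2 t @[t --> (0 : R)^'] --> kx.
  have [Ox|nOx] := pselect (Omega jx.2); last by exists 0.
  by have [kx kxP] := qcvg jx.1 jx.2 Ox; exists kx.
have [kap kapP] := choice kchoice.
exists (fun j x => kap (j, x)), K; split => //; split.
- move=> j x v Ox.
  apply/cvg_lim => //.
  have h1 : ip (kernel_quotient k j x t) v @[t --> (0 : R)^'] --> ip (kap (j, x)) v.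
    apply: (@cvg_comp _ _ _ _ (fun u => ip u v)); first exact: (kapP (j, x) Ox).
    exact: ip_continuous.
  rewrite ipC; apply: cvg_trans h1; apply: near_eq_cvg.
  near=> t; have [t0 Ot] : t != 0 /\ Omega (t *: delta_mx 0 j + x).
    by near: t; exact: near_shift_in.
  rewrite /kernel_quotient (ipZl ip_lin) (ipBl ip_lin) !(ipC _ v).
  by rewrite (kP _ Ot).2 (kP _ Ox).2.
- move=> j x y Ox Oy.
  have h1 : kernel_quotient k j x t - kernel_quotient k j y t @[t --> (0 : R)^'] -->
      kap (j, x) - kap (j, y).
    by apply: cvgB; [exact: (kapP (j, x) Ox)|exact: (kapP (j, y) Oy)].
  apply: (cvgr_to_le (cvg_norm h1)); near=> t.
  have [t0 Otx] : t != 0 /\ Omega (t *: delta_mx 0 j + x).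
    by near: t; exact: near_shift_in.
  have [_ Oty] : t != 0 /\ Omega (t *: delta_mx 0 j + y).
    by near: t; exact: near_shift_in.
  exact: Kxy.
Unshelve. all: end_near. Qed.

Variables (C : set E) (f : E -> E) (U : set E) (g : E -> E).
Hypothesis C_sub : C `<=` Omega.
Hypothesis CU : C `<=` U.
Hypothesis g_cont : forall j x, U x -> {for x, continuous (fun x => g x 0 j)}.
Hypothesis fg : forall x, C x -> f x = g x.

(** Near [x] the representers of the partial derivatives stay bounded, so
    multiplying them by components that are continuous along [C] gives a
    continuous function on [C]. *)
Lemma orbital_derivative_representer : exists rho : E -> H,
  (forall x v, C x -> orbital_derivative f (ev v) x = ip v (rho x)) /\
  (forall x, C x -> forall e, 0 < e ->
    \forall y \near x, C y -> `|rho x - rho y| <= e).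
Proof.
have [kappa [K [K0 [kapD kapL]]]] := pderiv_representers.
exists (fun x => \sum_j f x 0 j *: kappa j x); split.
  move=> x v Cx; rewrite ipC (ip_suml ip_lin) /orbital_derivative /dotp.
  by apply: eq_bigr => j _; rewrite mxE (kapD j x v (C_sub Cx)) mulrC (ipC v).
move=> x Cx e e0.
have Ox := C_sub Cx.
have main j : \forall y \near x, C y ->
    `|f x 0 j *: kappa j x - f y 0 j *: kappa j y| <= e / d%:R.
  have dR : 0 < d%:R :> R by rewrite ltr0n.
  pose A := `|g x 0 j|; pose B := `|kappa j x| + 1.
  have B0 : 0 < B by rewrite ltr_pwDr.
  have A0 : 0 < A + 1 by rewrite ltr_pwDr ?normr_ge0.
  pose eta := e / d%:R / (2 * B); pose zeta := e / d%:R / (2 * (A + 1)).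
  have eta0 : 0 < eta by rewrite !divr_gt0// mulr_gt0.
  have zeta0 : 0 < zeta by rewrite !divr_gt0// mulr_gt0.
  pose xi := Num.min 1 zeta / (K + 1).
  have xi0 : 0 < xi by rewrite divr_gt0 ?lt_min ?ltr01// ltr_pwDr.
  have h1 : \forall y \near x, `|g x 0 j - g y 0 j| < eta.
    by have /cvgrPdist_lt/(_ _ eta0) := g_cont (j := j) (CU Cx).
  have h2 : \forall y \near x, `|x - y| < xi.
    have idx : y @[y --> x] --> x by exact: cvg_id.
    by have /cvgrPdist_lt/(_ _ xi0) := idx.
  near=> y => Cy; have Oy := C_sub Cy.
  have gy : `|g x 0 j - g y 0 j| < eta by near: y.
  have xy : `|x - y| < xi by near: y.
  have kk : `|kappa j x - kappa j y| <= Num.min 1 zeta.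
    apply: (le_trans (kapL j x y Ox Oy)).
    apply: (@le_trans _ _ (K * xi)); first by rewrite ler_wpM2l// ltW.
    rewrite /xi mulrA ler_pdivrMr ?ltr_pwDr// mulrC ler_wpM2l ?lerDl//.
    by rewrite ltW// lt_min ltr01.
  have kB : `|kappa j y| <= B.
    rewrite -[kappa j y](subKr (kappa j x)) (le_trans (ler_normB _ _))// lerD2l.
    by rewrite (le_trans kk)// ge_min lexx.
  rewrite !fg//.
  (* eta and zeta are chosen so that each half of this splitting contributes at
     most e / (2 d). *)
  rewrite (_ : _ - _ = (g x 0 j - g y 0 j) *: kappa j y + g x 0 j *: (kappa j x - kappa j y)).
    rewrite (le_trans (ler_normD _ _))// !normrZ.
    rewrite [leRHS](_ : _ = eta * B + (A + 1) * zeta); last first.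
      by rewrite /eta /zeta; field; rewrite !gt_eqF.
    apply: lerD; first by rewrite ler_pM// ltW.
    apply: ler_pM => //; first by rewrite lerDl.
    by rewrite (le_trans kk)// ge_min lexx orbT.
  by rewrite scalerBl scalerBr [RHS]addrC addrA subrK.
have mainall : \forall y \near x, forall j, C y ->
    `|f x 0 j *: kappa j x - f y 0 j *: kappa j y| <= e / d%:R.
  exact: filter_forall main.
apply: filterS mainall => y mainy Cy.
rewrite -sumrB (le_trans (ler_norm_sum _ _ _))//.
rewrite [leRHS](_ : _ = \sum_(j < d) e / d%:R); last first.
  by rewrite sumr_const card_ord -[RHS]mulr_natr divfK// pnatr_eq0 -lt0n.
by apply: ler_sum => j _; exact: mainy.
Unshelve. all: end_near. Qed.

End derivative_representers.

(** * Convergence of the discretised problems *)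

Section fill_distance.
Context (R : realType) (d : nat).
Local Notation E := 'rV[R]_d.

Lemma norm_le_enorm (x : E) : `|x| <= enorm x.
Proof.
have e0 : 0 <= enorm x by rewrite sqrtr_ge0.
apply: norm_le_coord => // i.
by rewrite -(@ler_pXn2r _ 2)// ?nnegrE// real_normK ?num_real// coord_sqr_le_enorm.
Qed.

(** A fill distance below [r] makes the infimum of the distances from [x] less
    than [r], so some point of [X n] is at distance less than [r]; the infimum
    over an empty point set is infinite. *)
Lemma fill_distance_cvg0 (X : nat -> set E) (C : set E) :
  fill_distance (X n) C @[n --> \oo] --> (0 : \bar R) ->
  forall x, C x -> forall r, 0 < r ->
    \forall n \near \oo, exists2 z, X n z & `|x - z| < r.
Proof.
move=> Xfill x Cx r r0.
have h : \forall n \near \oo, (fill_distance (X n) C < r%:E)%E.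
  apply: (Xfill [set y | (y < r%:E)%E]); apply: open_nbhs_nbhs; split => /=.
    exact: open_ereal_lt_ereal.
  by rewrite lte_fin.
apply: filterS h => n; rewrite /fill_distance gt_max => /andP[_ supr].
have : (ereal_inf [set (enorm (x - z))%:E | z in X n] < r%:E)%E.
  apply: le_lt_trans supr; apply: ereal_sup_ubound; by exists x.
move=> /ereal_inf_lt[_ [z Xz <-]]; rewrite lte_fin => xz.
by exists z => //; rewrite (le_lt_trans (norm_le_enorm _)).
Qed.

End fill_distance.

Theorem theorem3p5 (R : realType) (d : nat) (d_gt0 : (0 < d)%N)
    (alpha : R) (alpha_gt : d%:R / 2 + 2 < alpha)
    (Omega : set 'rV[R]_d) (Omega_dom : bounded_lipschitz_domain Omega)
    (Omega0 : interior Omega 0)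
    (k : nat) (C : 'I_k -> set 'rV[R]_d)
    (C_sub : forall i, C i `<=` Omega)
    (C_closed : forall i, exists2 F : set 'rV[R]_d, closed F & C i = F `&` Omega)
    (C_cover : \bigcup_i C i = Omega)
    (f : 'I_k -> 'rV[R]_d -> 'rV[R]_d)
    (f_class : forall i, exists (U : set 'rV[R]_d) (g : 'rV[R]_d -> 'rV[R]_d),
      [/\ open U, C i `<=` U, vfield_class_Cr (alpha - 1) U g
        & forall x, C i x -> f i x = g x])
    (f0 : forall i, C i 0 -> f i 0 = 0)
    (b : 'I_k -> 'rV[R]_d -> R)
    (b_cont : forall i, {within C i, continuous (b i)})
    (Phi : 'rV[R]_d -> R) (Phi_kernel : sobolev_kernel_function alpha Phi)
    (H : completeNormedModType R) (ip : H -> H -> R) (ev : H -> 'rV[R]_d -> R)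
    (H_rkhs : sobolev_rkhs Omega alpha Phi ip ev)
    (Z : nat -> set 'rV[R]_d)
    (Z_finite : forall n, (0 < n)%N -> finite_set (Z n))
    (Z_sub : forall n, (0 < n)%N -> Z n `<=` Omega)
    (Z_fill : forall i,
      fill_distance (Z n `&` C i) (C i) @[n --> \oo] --> (0 : \bar R))
    (V0 : H) (V0_feasible : feasible ev f b C V0)
    (eps : R) (eps_gt0 : 0 < eps) (veps : nat -> H)
    (veps_feasible : forall n, (0 < n)%N ->
      feasible ev f b (fun i => Z n `&` C i) (veps n))
    (veps_norm : forall n, (0 < n)%N ->
      `|veps n| <= eps / n%:R
        + inf [set `|v| | v in feasible ev f b (fun i => Z n `&` C i)]) :
  exists v : H,
    unique (min_norm (feasible ev f b C)) v /\ veps n @[n --> \oo] --> v.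
Proof.
have [openO _ _ _ _] := Omega_dom.
have ipC := rkhs_ipC H_rkhs.
have ip_lin := rkhs_ip_linear H_rkhs.
have ip_norm := rkhs_ip_norm H_rkhs.
have /choice[rho rhoP] i : exists rho : 'rV[R]_d -> H,
    (forall x v, C i x -> orbital_derivative (f i) (ev v) x = ip v (rho x)) /\
    (forall x, C i x -> forall e, 0 < e ->
      \forall y \near x, C i y -> `|rho x - rho y| <= e).
  have [U [g [openU CU gU fg]]] := f_class i.
  apply: (orbital_derivative_representer d_gt0 alpha_gt openO Phi_kernel H_rkhs
    (@C_sub i) CU _ fg).
  move=> j x Ux; have [gj _] := gU j.
  (* Whatever the order of differentiability, continuity is its first clause. *)
  by move: gj; case: (Num.truncn _) => [|m] /= [gc _]; exact: gc.
have feasE (X : 'I_k -> set 'rV[R]_d) (v : H) : (forall i, X i `<=` C i) ->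
    feasible ev f b X v <-> (forall i x, X i x -> ip v (rho i x) <= b i x).
  move=> XC; split => h i x Xx; have := h i x Xx.
    by rewrite (rhoP i).1//; exact: XC.
  by rewrite (rhoP i).1//; exact: XC.
have feasCE v := feasE C v (fun i x Cx => Cx).
have ZC n i : Z n `&` C i `<=` C i by move=> x [].
pose B p := [set v : H | forall i x c, C i x ->
  (forall n, (p <= n)%N -> (0 < n)%N -> ip (veps n) (rho i x) <= c) ->
  b i x <= c -> ip v (rho i x) <= c].
have bounded_veps n : (0 < n)%N -> forall v, feasible ev f b C v ->
    `|veps n| <= eps / n%:R + `|v|.
  move=> n0 v fv; apply: (le_trans (veps_norm n n0)); rewrite lerD2l.
  apply: ge_inf; first by exists 0 => _ [w _ <-].
  by exists v => // i x [_ Cx]; exact: fv.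
have capB : \bigcap_p B p = feasible ev f b C.
  apply/seteqP; split => v; last first.
    move=> /feasCE fv p _ i x c Cx _ bc.
    exact: le_trans (fv i x Cx) bc.
  move=> Bv; apply/feasCE => i x Cx.
  apply/ler_addgt0Pr => e e0.
  (* M bounds the norms of all veps n, and D_i (veps n) is compared at x and at a
     nearby point z of Z n, where the constraint of the discretised problem is
     available. *)
  pose M := eps + `|V0| + 1.
  have M0 : 0 < M by rewrite ltr_pwDr// addr_ge0// ltW.
  have e20 : 0 < e / 2 by rewrite divr_gt0.
  have eM0 : 0 < e / 2 / M by rewrite divr_gt0.
  have rx := (rhoP i).2 x Cx _ eM0.
  have bx : \forall y \near x, C i y -> `|b i x - b i y| <= e / 2.
    by have /cvgrPdist_le/(_ _ e20) := (subspace_continuousP _ _).1 (b_cont i) x Cx.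
  have /nbhs_ballP[r /= r0 rball] : \forall y \near x, C i y ->
      `|rho i x - rho i y| <= e / 2 / M /\ `|b i x - b i y| <= e / 2.
    by near=> y => Cy; split; [move: Cy; near: y|move: Cy; near: y].
  have [p _ pZ] := fill_distance_cvg0 (Z_fill i) Cx r0.
  apply: (Bv p I i x _ Cx); last by rewrite lerDl ltW.
  move=> n pn n0; have [z Zz xz] := pZ n pn.
  have [rxz bxz] : `|rho i x - rho i z| <= e / 2 / M /\ `|b i x - b i z| <= e / 2.
    by apply: rball; [rewrite -ball_normE|case: Zz].
  have fz : ip (veps n) (rho i z) <= b i z.
    by have /feasE := veps_feasible n n0; apply.
  have vM : `|veps n| <= M.
    rewrite (le_trans (bounded_veps n n0 V0 V0_feasible))// /M -addrA lerD//.
      by rewrite ler_pdivrMr ?ltr0n// ler_peMr ?ler1n// ltW.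
    by rewrite lerDl.
  have cs := cauchy_schwarz ipC ip_lin ip_norm (veps n) (rho i x - rho i z).
  have : ip (veps n) (rho i x - rho i z) <= e / 2.
    rewrite (le_trans (ler_norm _))// (le_trans cs)//.
    by rewrite [leRHS](_ : _ = M * (e / 2 / M)) ?ler_pM//; field; rewrite gt_eqF.
  rewrite (ipBr ipC ip_lin); move: bxz; rewrite ler_norml => /andP[bxz _].
  by lra.
rewrite -capB; apply: (min_norm_limit ipC ip_lin ip_norm (eps := eps) (v0 := V0)).
- move=> p u v Bu Bv i x c Cx wc bc.
  have := Bu i x c Cx wc bc; have := Bv i x c Cx wc bc.
  by rewrite (ipZl ip_lin) (ipDl ip_lin); lra.
- move=> p.
  have -> : B p = \bigcap_(q in [set q : 'I_k * 'rV[R]_d * R | [/\ C q.1.1 q.1.2,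
      (forall n, (p <= n)%N -> (0 < n)%N -> ip (veps n) (rho q.1.1 q.1.2) <= q.2)
      & b q.1.1 q.1.2 <= q.2]]) [set v | ip v (rho q.1.1 q.1.2) <= q.2].
    apply/seteqP; split => v Bv.
      by move=> [[i x] c] [/= Cx wc bc]; exact: Bv.
    by move=> i x c Cx wc bc; exact: (Bv (i, x, c)).
  apply: closed_bigI => -[[i x] c] _ /=.
  apply: (closed_comp (f := fun v => ip v (rho i x)) (D := [set y | y <= c])).
    by move=> v _; exact: (ip_continuous H_rkhs).
  exact: closed_le.
- move=> p q pq v Bv i x c Cx wc bc; apply: Bv => // n qn; apply: wc.
  exact: leq_trans qn.
- near=> n => i x c Cx wc _; apply: wc => //.
  by near: n; exact: nbhs_infty_gt.
- by rewrite capB.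
- by rewrite capB => v fv n n0; exact: bounded_veps.
Unshelve. all: end_near. Qed.
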